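(* Let $X_0,X_1$ be Banach spaces with $X_1\subset X_0$ continuously, such that $(X_0,X_1)$ is linearisable with linearisation operators $(\Lambda(t))_{0<t\le1}$. Let $\widetilde{X}_1=\bigcap_{k=1}^nX_1^k$, where $(X_1^k)_{1\le k\le n}$ are closed subspaces of $X_1$ which are independent, with respective interpolation orders $\theta_1<\theta_2<\cdots<\theta_n$ in $]0,1[$ associated to Banach spaces $Y_1,\dots,Y_n$. For $1\le j\le n$ let $\Pi_j$ be the projection $X_1\to X_1/X_1^j\hookrightarrow Y_j$. Let $0<\theta<1$ and $1\le p\le\infty$. (1) If $\theta\notin\{\theta_j: 1\le j\le n\}$, let $k$ be the largest integer such that $\theta_k<\theta$ ($k=0$ if there is none). Then for $j\le k$ the projection $\Pi_j$ extends continuously to a map $[X_0,X_1]_{\theta,p}\to Y_j$ (still denoted $\Pi_j$), and $$[X_0,\widetilde{X}_1]_{\theta,p}=[X_0,X_1]_{\theta,p}\cap\Big(\bigcap_{j\le k}\mathrm{Ker}\,\Pi_j\Big).$$ (2) If there exists $k$ such that $\theta=\theta_k$, then $$[X_0,\widetilde{X}_1]_{\theta,p}=\Big\{u\in[X_0,X_1]_{\theta,p}\cap\Big(\bigcap_{j<k}\mathrm{Ker}(\Pi_j)\Big):\ \big\|\,\|\Lambda(t)u\|_{Y_k}\big\|_{L^p(]0,1],dt/t)}<\infty\Big\},$$ where for $j<k$, $\mathrm{Ker}(\Pi_j)$ is the kernel of the continuous extension of $\Pi_j$ to $[X_0,X_1]_{\theta,p}$.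
   Context: $A\sim B$ means $C_1A\le B\le C_2A$ with positive constants independent of all parameters; $A\lesssim B$ means $A\le CB$ similarly. Subspaces of $X_1$ carry the norm of $X_1$. Empty intersections of kernels are the whole space. Real interpolation: with $K(t,u)=\inf\{\|u_0\|_{X_0}+t\|u_1\|_{X_1}: u=u_0+u_1,\ u_0\in X_0,\ u_1\in X_1\}$, the space $[X_0,X_1]_{\theta,p}$ is the set of $u\in X_0$ with $\|t^{-\theta}K(t,u)\|_{L^p(]0,\infty[,dt/t)}<\infty$, with this norm; $[X_0,\widetilde{X}_1]_{\theta,p}$ is defined likewise with $\widetilde{X}_1$ in place of $X_1$. Linearisable couple: $(X_0,X_1)$ is linearisable with linearisation operators $(\Lambda(t))_{0<t\le1}$ if the $\Lambda(t):X_0\to X_1$ are linear maps such that $K(t,u)\sim\|u-\Lambda(t)u\|_{X_0}+t\|\Lambda(t)u\|_{X_1}$ for all $0<t\le1$, $u\in X_0$; equivalently, $\|u-\Lambda(t)u\|_{X_0}+t\|\Lambda(t)u\|_{X_1}\lesssim\min(\|u\|_{X_0},t\|u\|_{X_1})$ (with $\|u\|_{X_1}=\infty$ if $u\notin X_1$). Quotient $J$ norm: for $u\in X_1$, $t>0$ and $Z$ a closed subspace of $X_1$, $J(t,u)=\|u\|_{X_0}+t\|u\|_{X_1}$ and $N_{J,Z}(t,u)=\inf_{v\in Z}J(t,u-v)$. Interpolation order: a closed subspace $Z\subset X_1$ has interpolation order $\theta_0$, associated to $Y$, if $X_1/Z$ is embedded in a Banach space $(Y,\|\cdot\|_Y)$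 (meaning that there is a linear injective mapping $X_1/Z\to Y$, not necessarily an inclusion; for $w\in X_1$ one writes $\|w\|_Y$ for the $Y$-norm of the image of the class of $w$), such that for any $0<s,t\le1$ with $t\sim s$ and any $u,v\in X_0$, $N_{J,Z}(t,\Lambda(t)u+\Lambda(s)v)\sim t^{\theta_0}\|\Lambda(t)u+\Lambda(s)v\|_Y$. Here $t\sim s$ means $C^{-1}s\le t\le Cs$ for a constant $C\ge1$, the constants in the equivalence being allowed to depend on $C$ but not on $s,t,u,v$. Independence: closed subspaces $(X_1^k)_{1\le k\le n}$ of $X_1$, with respective interpolation orders $\theta_1<\cdots<\theta_n$ associated to $Y_1,\dots,Y_n$, are independent when, with $\widetilde{X}_1=\bigcap_{k=1}^nX_1^k$, for any $0<s,t\le1$ with $t\sim s$ and any $u,v\in X_0$, $$N_{J,\widetilde{X}_1}(t,\Lambda(t)u+\Lambda(s)v)\sim\sum_{k=1}^nt^{\theta_k}\|\Lambda(t)u+\Lambda(s)v\|_{Y_k}.$$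
   Formalization: Π_j need not extend continuously in general: the map on [X_0,X_1]_{θ,p} is the bounded linear limit of Π_jΛ(t)u as t→0, its kernel is used for Ker Π_j, and it is claimed to equal Π_j on X_1 only if Π_jΛ(t)w→Π_j w for all w in X_1, which any continuous extension forces. *)

(* Defs.v *)
From HB Require Import structures.
From mathcomp Require Import all_boot all_order all_algebra.
From mathcomp Require Import all_classical all_reals all_analysis.
From mathcomp Require Import ess_sup_inf complex.

Set Implicit Arguments.
Unset Strict Implicit.
Unset Printing Implicit Defensive.

Import Order.TTheory GRing.Theory Num.Theory.
Import numFieldNormedType.Exports.

Local Open Scope classical_set_scope.
Local Open Scope ring_scope.

(* Banach spaces are complete normed modules over [scalars R k], that is over
   R or over R[i].  The library norm takes its values in the scalar field, as
   a nonnegative element; [rnorm] is the same norm read as an element of R. *)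
Inductive scalar_kind := RealScalars | ComplexScalars.

Definition scalars (R : realType) (k : scalar_kind) : numFieldType :=
  match k with
  | RealScalars => R
  | ComplexScalars => R[i]%C
  end.

Definition scalar_re (R : realType) (k : scalar_kind) : scalars R k -> R :=
  match k return scalars R k -> R with
  | RealScalars => fun x : R => x
  | ComplexScalars => fun z : R[i]%C => complex.Re z
  end.

Definition rnorm (R : realType) (k : scalar_kind)
    (X : normedModType (scalars R k)) (x : X) : R := scalar_re `|x|.

Definition closed_subspace (K : numFieldType) (X : normedModType K)
    (Z : set X) : Prop :=
  [/\ closed Z, Z 0 & forall (a : K) (u v : X), Z u -> Z v -> Z (a *: u + v)].

(* The norm of L^p(D, dt/t) for D included in ]0, +oo[ (junk value 0 at
   p = -oo).  For p = +oo the measures dt/t and dt have the same null sets.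
   [f] need not be measurable: the integral of a nonnegative function is then
   the supremum of the integrals of the simple functions below it. *)
Definition Lp_dtt (R : realType) (D : set R) (p : \bar R) (f : R -> R)
    : \bar R :=
  match p with
  | r%:E%E =>
      poweR (\int[@lebesgue_measure R]_(t in D) (`|f t| `^ r / t)%:E) r^-1
  | +oo%E => ess_sup (@lebesgue_measure R) (fun t => `|(f \_ D) t|%:E)
  | -oo%E => 0%E
  end.

Section Interpolation.
Context (R : realType) (k : scalar_kind).
Context (X0 X1 : completeNormedModType (scalars R k)).
(* The inclusion of X_1 in X_0; subsets of X_1 carry the norm of X_1. *)
Variable i : {linear X1 -> X0}.

(* K functional of the couple (X_0, Z), for Z a subspace of X_1. *)
Definition Kfun (Z : set X1) (t : R) (u : X0) : R :=
  inf [set r : R | exists (u0 : X0) (u1 : X1),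
         [/\ Z u1, u = u0 + i u1 & r = rnorm u0 + t * rnorm u1]].

Definition interp_norm (Z : set X1) (theta : R) (p : \bar R) (u : X0)
    : \bar R :=
  Lp_dtt `]0, +oo[ p (fun t => t `^ (- theta) * Kfun Z t u).

Definition interp_space (Z : set X1) (theta : R) (p : \bar R) : set X0 :=
  [set u | (interp_norm Z theta p u < +oo)%E].

(* Only the operators Lam t with 0 < t <= 1 are relevant. *)
Variable Lam : R -> {linear X0 -> X1}.

Definition linearisable : Prop :=
  exists C1 C2 : R, [/\ 0 < C1, 0 < C2 &
    forall (t : R) (u : X0), 0 < t <= 1 ->
      C1 * Kfun setT t u <= rnorm (u - i (Lam t u)) + t * rnorm (Lam t u)
        <= C2 * Kfun setT t u].

Definition Jfun (t : R) (u : X1) : R := rnorm (i u) + t * rnorm u.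

Definition NJ (Z : set X1) (t : R) (u : X1) : R :=
  inf [set r : R | exists2 v : X1, Z v & r = Jfun t (u - v)].

(* A linear injection X_1/Z -> Y is represented by its composition Pi with the
   quotient map X_1 -> X_1/Z, i.e. by a linear map X_1 -> Y of kernel Z; thus
   ||w||_Y is rnorm (Pi w). *)
Definition interpolation_order (Z : set X1) (theta0 : R)
    (Y : completeNormedModType (scalars R k)) (Pi : {linear X1 -> Y}) : Prop :=
  (forall w : X1, Pi w = 0 <-> Z w) /\
  forall C : R, 1 <= C -> exists C1 C2 : R, [/\ 0 < C1, 0 < C2 &
    forall (s t : R) (u v : X0),
      0 < s <= 1 -> 0 < t <= 1 -> C^-1 * s <= t <= C * s ->
      let w := Lam t u + Lam s v in
      C1 * NJ Z t w <= t `^ theta0 * rnorm (Pi w) <= C2 * NJ Z t w].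

Definition independent_subspaces (n : nat) (Z : 'I_n -> set X1)
    (th : 'I_n -> R) (Y : 'I_n -> completeNormedModType (scalars R k))
    (Pi : forall j, {linear X1 -> Y j}) : Prop :=
  forall C : R, 1 <= C -> exists C1 C2 : R, [/\ 0 < C1, 0 < C2 &
    forall (s t : R) (u v : X0),
      0 < s <= 1 -> 0 < t <= 1 -> C^-1 * s <= t <= C * s ->
      let w := Lam t u + Lam s v in
      let N := NJ (\bigcap_(j in [set: 'I_n]) Z j) t w in
      C1 * N <= \sum_(j < n) t `^ th j * rnorm (Pi j w) <= C2 * N].

(* Pe is the continuous extension of Pi to [X_0, X_1]_{theta,p}: a bounded
   linear map (its values outside that space are irrelevant), which is the
   limit of Pi (Lam t u) as t -> 0.  This last property singles out one
   extension for p = +oo, where X_1 need not be dense.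
   Agreement with Pi on all of X_1 is required only if Pi (Lam t w) tends to
   Pi w for every w in X_1.  This holds whenever Pi has any continuous extension
   to [X_0, X_1]_{theta,p}, because Lam t w tends to w there; it does not
   follow from the definition of the interpolation order, which controls Pi
   only on the ranges of the Lam t.  For instance, let ||x||_{X_0} and
   ||x||_{X_1} be the suprema of |x_m| and of 2^m |x_m| over m, Lam t the
   truncation to 2^-m >= t, L a Banach limit, 0 < th < 1, and
     Pi x = (\sum_m 2^(m th) x_m, L ((2^m x_m)_m)) : X_1 -> R^2.
   The kernel of Pi has order th, but L vanishes on finite sequences and is
   not continuous for the norm of [X_0, X_1]_{theta,p}. *)
Definition continuous_extension (theta : R) (p : \bar R)
    (Y : completeNormedModType (scalars R k)) (Pi : {linear X1 -> Y})
    (Pe : X0 -> Y) : Prop :=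
  let E := interp_space setT theta p in
  [/\ forall (a : scalars R k) (u v : X0), E u -> E v ->
        Pe (a *: u + v) = a *: Pe u + Pe v,
      exists C : R, forall u : X0, E u ->
        ((rnorm (Pe u))%:E <= C%:E * interp_norm setT theta p u)%E,
      forall u : X0, E u -> Pi (Lam t u) @[t --> 0^'+] --> Pe u &
      (forall w : X1, Pi (Lam t (i w)) @[t --> 0^'+] --> Pi w) ->
        forall w : X1, Pe (i w) = Pi w].

End Interpolation.

(* With theta_1 < ... < theta_n, the largest k such that theta_k < theta, or 0
   if there is none; j : 'I_n stands for the index j.+1. *)
Definition last_below (R : realType) (n : nat) (th : 'I_n -> R) (theta : R)
    : nat := \max_(j < n | th j < theta) j.+1.

(* Main.v *)
Require Import Defs.
From HB Require Import structures.
From mathcomp Require Import all_boot all_order all_algebra.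
From mathcomp Require Import all_classical all_reals all_analysis.
From mathcomp Require Import measurable_realfun ess_sup_inf hoelder complex ring lra.

(** Everything is discretised along t = 2^-m. Since t -> K(t,u) increases and
  t -> K(t,u)/t decreases, u belongs to an interpolation space for (X_0, Z)
  exactly when the sequence 2^(m theta) K_Z(2^-m, u) is in l^p
  ([interp_spaceP]). The half line t >= 1 is harmless because
  K_Z(t,u) <= ||u||.

  Splitting u = (u - Lam t u) + Lam t u and optimising over the intersection Zt
  gives K_Zt(t,u) ~ K(t,u) + N_{J,Zt}(t, Lam t u), and independence turns the
  last term into the sum of the t^(th_j) ||Pi_j (Lam t u)||. Hence u is in
  [X_0, Zt]_{theta,p} iff it is in [X_0, X_1]_{theta,p} and, for every j, the
  sequence d_j(m) = 2^(m (theta - th_j)) ||Pi_j (Lam 2^-m u)|| is in l^p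
  ([interp_intersectionP]).

  The definition of the order of a subspace bounds the increments:
  ||Pi_j (Lam t u - Lam s u)|| <= C t^(-th_j) K(t,u) for t comparable to s. With
  a(m) = 2^(m theta) K(2^-m, u) in l^p, this compares d_j(m) and d_j(m+1), and
  three cases arise.
  - If th_j > theta, then d_j(m+1) <= q (d_j(m) + C a(m)) with q < 1, a
    contracting recursion that keeps d_j in l^p ([ell_forward]): there is no
    condition on u.
  - If th_j < theta, the increments of t -> Pi_j (Lam t u) decay geometrically,
    so it converges as t -> 0. The limit is the continuous extension of Pi_j.
    Now d_j(m) <= q d_j(m+1) + C a(m), which can be solved from infinity once the
    limit is zero ([ell_backward]); conversely d_j bounded forces
    ||Pi_j (Lam 2^-m u)|| -> 0.
  - If th_j = theta, then ||Pi_j (Lam t u)|| differs from its value at 2^-m by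
    O(a(m)) on ]2^-(m+1), 2^-m], so d_j is in l^p iff t -> ||Pi_j (Lam t u)|| is
    in L^p(dt/t) on ]0, 1].

  Both recursions are special cases of Hardy's inequality for a geometric kernel.
  Convexity of x^p turns them into recursions between p-th powers with the same
  ratio q < 1, and these are summed directly. *)

Set Implicit Arguments.
Unset Strict Implicit.
Unset Printing Implicit Defensive.

Import Order.TTheory GRing.Theory Num.Theory.
Import numFieldNormedType.Exports.

Local Open Scope classical_set_scope.
Local Open Scope ring_scope.

(** * The sequence spaces l^p and geometric recursions *)

Section SequenceSpaces.
Context {R : realType}.
Implicit Types (p : \bar R) (a b d : nat -> R).

(** Membership in l^p for nonnegative sequences; [-oo] is a junk case. *)
Definition ell p a : Prop :=
  match p with
  | r%:E%E => exists M, forall N, \sum_(m < N) a m `^ r <= M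
  | _ => exists M, forall m, a m <= M
  end.

(** Convexity: q x + c y is the mean of x and c y / (1 - q) with weights q and
    1 - q. The coefficient of [x `^ r] stays q < 1, which is what lets the
    recursions below be summed. *)
Lemma powR_affine_le (r q c : R) : 1 <= r -> 0 <= q < 1 -> 0 <= c ->
  exists2 C, 0 <= C & forall x y, 0 <= x -> 0 <= y ->
    (q * x + c * y) `^ r <= q * x `^ r + C * y `^ r.
Proof.
move=> r1 /andP[q0 q1] c0.
have q1' : 0 < 1 - q by lra.
exists ((1 - q) * (c / (1 - q)) `^ r); first by rewrite mulr_ge0 ?powR_ge0 ?ltW.
move=> x y x0 y0.
have q01 : 0 <= q <= 1 by rewrite q0 ltW.
have cq : 0 <= c / (1 - q) by rewrite divr_ge0// ltW.
have cy : 0 <= c / (1 - q) * y by rewrite mulr_ge0.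
have cE : (1 - q) * (c / (1 - q)) = c by rewrite mulrC divfK// gt_eqF.
have : (q * x + (1 - q) * (c / (1 - q) * y)) `^ r <=
    q * x `^ r + (1 - q) * (c / (1 - q) * y) `^ r.
  by apply: (convex_powR r1 (Itv01 q0 (ltW q1))); rewrite inE/= in_itv/= ?x0 ?cy.
by rewrite (mulrA (1 - q) _ y) cE (powRM _ cq y0) (mulrA (1 - q) _ (y `^ r)).
Qed.

Lemma ell_le p a b : (1 <= p)%E -> (forall m, 0 <= b m <= a m) ->
  ell p a -> ell p b.
Proof.
case: p => [r|_|_] //=; last first.
- by move=> ba [M aM]; exists M => m; apply: le_trans (aM m); case/andP: (ba m).
rewrite lee_fin => r1 ba [M aM]; exists M => N; apply: le_trans (aM N).
apply: ler_sum => m _; have /andP[b0 bam] := ba m.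
by rewrite ge0_ler_powR ?nnegrE ?(le_trans _ r1)// (le_trans b0).
Qed.

Lemma ell_scale p a (c : R) : (1 <= p)%E -> 0 <= c -> (forall m, 0 <= a m) ->
  ell p a -> ell p (fun m => c * a m).
Proof.
case: p => [r|_|_] //=; last first.
- by move=> c0 _ [M aM]; exists (c * M) => m; rewrite ler_wpM2l.
rewrite lee_fin => r1 c0 a0 [M aM]; exists (c `^ r * M) => N.
under eq_bigr do rewrite powRM//.
by rewrite -mulr_sumr ler_wpM2l// powR_ge0.
Qed.

Lemma ell_add p a b : (1 <= p)%E -> (forall m, 0 <= a m) ->
  (forall m, 0 <= b m) -> ell p a -> ell p b -> ell p (fun m => a m + b m).
Proof.
move=> p1 a0 b0 ea eb.
have := ell_scale p1 (ler0n _ 2) a0 ea; move: p1 ea eb.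
case: p => [r|_|_] //=; last first.
- by move=> [M aM] [N bN] _; exists (M + N) => m; rewrite lerD.
rewrite lee_fin => r1 _ [M bM] [N aN].
have [| |C C0 CP] := @powR_affine_le r 2^-1 1 r1; [lra|lra|].
exists (2^-1 * N + C * M) => n.
apply: (@le_trans _ _ (\sum_(m < n) (2^-1 * (2 * a m) `^ r + C * b m `^ r))).
  apply: ler_sum => m _; have := CP (2 * a m) (b m).
  by rewrite mulKf// mul1r; apply=> //; rewrite mulr_ge0.
by rewrite big_split/= -!mulr_sumr lerD// ler_wpM2l// invr_ge0.
Qed.

Lemma ell_zero p : (1 <= p)%E -> ell p (fun=> 0).
Proof.
case: p => [r|_|_] //=; rewrite ?lee_fin; last by exists 0.
move=> r1; exists 0 => N; rewrite big1// => m _.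
by rewrite powR0// gt_eqF// (lt_le_trans _ r1).
Qed.

Lemma ell_sum p (I : finType) (a : I -> nat -> R) : (1 <= p)%E ->
    (forall j m, 0 <= a j m) -> (forall j, ell p (a j)) ->
  ell p (fun m => \sum_j a j m).
Proof.
move=> p1 a0 ea; elim: (index_enum I) => [|j s IH].
  by apply: ell_le p1 _ (ell_zero p1) => m; rewrite big_nil lexx.
have s0 m : 0 <= \sum_(l <- s) a l m by rewrite sumr_ge0.
apply: ell_le p1 _ (ell_add p1 (a0 j) s0 (ea j) IH) => m.
by rewrite big_cons lexx andbT addr_ge0.
Qed.

Lemma ell_bounded p a : (1 <= p)%E -> (forall m, 0 <= a m) -> ell p a ->
  exists2 M, 0 <= M & forall m, a m <= M.
Proof.
case: p => [r|_|_] //=; last first.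
- by move=> a0 [M aM]; exists M => //; exact: le_trans (aM 0%N).
rewrite lee_fin => r1 a0 [M aM].
have M0 : 0 <= M by have := aM 0%N; rewrite big_ord0.
exists (M + 1) => [|m]; first by rewrite addr_ge0.
have [am1|am1] := leP (a m) 1; first by rewrite (le_trans am1)// lerDr.
apply: (le_trans (le1r_powR (ltW am1) r1)).
apply: (@le_trans _ _ M); last by rewrite lerDl.
apply: le_trans (aM m.+1); rewrite big_ord_recr/= lerDr.
by apply: sumr_ge0 => j _; exact: powR_ge0.
Qed.

(** After raising to the power r, the recursion sums to
    S_(N+1) <= B + q S_N, so the partial sums never exceed B / (1 - q). *)
Lemma ell_forward p a d (q c : R) : (1 <= p)%E -> 0 <= q < 1 -> 0 <= c ->
    (forall m, 0 <= a m) -> (forall m, 0 <= d m) ->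
    (forall m, d m.+1 <= q * d m + c * a m) ->
  ell p a -> ell p d.
Proof.
move=> p1 q01 c0 a0 d0 dS ea; have /andP[q0 q1] := q01.
have q1' : 0 < 1 - q by lra.
(* a fixed point of the affine recursion is an upper bound *)
have fixpt B : B = B / (1 - q) - q * (B / (1 - q)) by field; rewrite gt_eqF.
have bnd (x : nat -> R) B : 0 <= B -> x 0%N <= B ->
    (forall m, x m.+1 <= B + q * x m) -> forall m, x m <= B / (1 - q).
  move=> B0 x0 xS; elim => [|m IH].
    by rewrite (le_trans x0)// ler_pdivlMr// ler_piMr//; lra.
  apply: (le_trans (xS m)); rewrite -lerBrDl {2}(fixpt B) opprB addrCA subrr addr0.
  by rewrite ler_wpM2l.
have [M M0 aM] := ell_bounded p1 a0 ea.
have dinf : exists M', forall m, d m <= M'.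
  exists ((d 0%N + c * M) / (1 - q)); apply: bnd => [||m].
  - by rewrite addr_ge0 ?mulr_ge0.
  - by rewrite lerDl mulr_ge0.
  - rewrite (le_trans (dS m))// addrC lerD2r (le_trans (ler_wpM2l c0 (aM m)))//.
    by rewrite lerDr.
case: p p1 ea => [r||] //= r1 [A aA].
have {}r1 : 1 <= r by rewrite -lee_fin.
have r0 : 0 <= r by rewrite (le_trans _ r1).
have [C C0 CP] := powR_affine_le r1 q01 c0.
have A0 : 0 <= A by have := aA 0%N; rewrite big_ord0.
exists ((d 0%N `^ r + C * A) / (1 - q)); apply: bnd => [||N].
- by rewrite addr_ge0 ?powR_ge0// mulr_ge0.
- by rewrite big_ord0 addr_ge0 ?powR_ge0// mulr_ge0.
rewrite big_ord_recl -addrA lerD2l.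
apply: (@le_trans _ _ (\sum_(m < N) (q * d m `^ r + C * a m `^ r))).
  apply: ler_sum => m _; rewrite lift0.
  apply: (le_trans _ (CP _ _ (d0 m) (a0 m))).
  by rewrite ge0_ler_powR ?nnegrE ?addr_ge0 ?mulr_ge0.
by rewrite big_split/= -!mulr_sumr addrC lerD2r ler_wpM2l.
Qed.

Lemma ell_geometric p (q c : R) : (1 <= p)%E -> 0 <= q < 1 -> 0 <= c ->
  ell p (fun m => c * q ^+ m).
Proof.
move=> p1 q01 c0; have /andP[q0 q1] := q01.
apply: (@ell_forward p (fun=> 0) _ q 0) => // [m|m|].
- by rewrite mulr_ge0// exprn_ge0.
- by rewrite exprS mulrCA mulr0 addr0.
exact: ell_zero.
Qed.

(** The recursion is unrolled towards infinity. The condition on [q ^+ m * d m]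
    kills the remainder and gives boundedness of d, which then absorbs the
    boundary term [d N] when the recursion is summed. *)
Lemma ell_backward p a d (q c : R) : (1 <= p)%E -> 0 < q < 1 -> 0 <= c ->
    (forall m, 0 <= a m) -> (forall m, 0 <= d m) ->
    (forall m, d m <= q * d m.+1 + c * a m) ->
    (forall e, 0 < e -> exists N, forall m, (N <= m)%N -> q ^+ m * d m <= e) ->
  ell p a -> ell p d.
Proof.
move=> p1 /andP[q0 q1] c0 a0 d0 dS dlim ea.
have q01 : 0 <= q < 1 by rewrite ltW.
have q1' : 0 < 1 - q by lra.
have [M M0 aM] := ell_bounded p1 a0 ea.
have cM : 0 <= c * M by rewrite mulr_ge0.
have dinf : forall m, d m <= c * M / (1 - q).
  move=> m.
  have iter_dS l : d m <= q ^+ l * d (m + l)%N + c * M / (1 - q).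
    have : d m <= q ^+ l * d (m + l)%N + c * M / (1 - q) * (1 - q ^+ l).
      elim: l => [|l IH]; first by rewrite expr0 addn0 subrr mulr0 addr0 mul1r.
      apply: (le_trans IH).
      have : q ^+ l * d (m + l)%N <= q ^+ l * (q * d (m + l.+1)%N + c * M).
        rewrite ler_wpM2l ?exprn_ge0 ?(ltW q0)//.
        rewrite (le_trans (dS (m + l)%N))// addnS lerD2l.
        by rewrite ler_wpM2l.
      move=> h; rewrite -lerBrDr (le_trans h)// exprS le_eqVlt; apply/orP; left.
      by apply/eqP; field; rewrite gt_eqF.
    move/le_trans; apply; rewrite lerD2l ler_piMr ?divr_ge0 ?(ltW q1')//.
    by rewrite lerBlDr lerDl exprn_ge0 ?(ltW q0).
  apply/ler_addgt0Pr => e e0.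
  have [|N dN] := dlim (q ^+ m * e); first by rewrite mulr_gt0 ?exprn_gt0.
  have := iter_dS N; move/le_trans; apply; rewrite addrC lerD2l.
  have := dN (m + N)%N (leq_addl _ _).
  by rewrite exprD -mulrA ler_pM2l ?exprn_gt0.
case: p p1 ea => [r||] //= r1; last first.
- by exists (c * M / (1 - q)).
move=> [A aA].
have {}r1 : 1 <= r by rewrite -lee_fin.
have r0 : 0 <= r by rewrite (le_trans _ r1).
have [C C0 CP] := powR_affine_le r1 q01 c0.
have A0 : 0 <= A by have := aA 0%N; rewrite big_ord0.
set D := c * M / (1 - q) in dinf.
exists ((D `^ r + C * A) / (1 - q)) => N; rewrite ler_pdivlMr// mulrBr mulr1.
rewrite lerBlDr.
apply: (@le_trans _ _ (\sum_(m < N) (q * d m.+1 `^ r + C * a m `^ r))).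
  apply: ler_sum => m _; apply: (le_trans _ (CP _ _ (d0 m.+1) (a0 m))).
  by rewrite ge0_ler_powR ?nnegrE ?addr_ge0 ?mulr_ge0 ?(ltW q0).
rewrite big_split/= -!mulr_sumr addrAC lerD ?ler_wpM2l//.
have shift : \sum_(m < N) d m.+1 `^ r <= \sum_(m < N) d m `^ r + D `^ r.
  have dN : d N `^ r <= D `^ r.
    by rewrite ge0_ler_powR ?nnegrE// (le_trans (d0 N)).
  apply: (le_trans _ (lerD (lexx _) dN)).
  rewrite -[leRHS](@big_ord_recr _ _ +%R N (fun m => d m `^ r)) big_ord_recl.
  by rewrite lerDr powR_ge0.
rewrite addrC (le_trans (ler_wpM2l (ltW q0) shift))// mulrDr [_ * q]mulrC lerD2l.
by rewrite ler_piMl ?powR_ge0 ?(ltW q1).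
Qed.
End SequenceSpaces.

(** * Dyadic discretisation of the norms of L^p(dt/t) *)

Section DyadicIntegrals.
Context {R : realType}.
Implicit Types (p : \bar R) (a b : nat -> R) (f : R -> R) (D : set R).
Local Notation mu := (@lebesgue_measure R).

(** The integral of a nonnegative function is a supremum over the simple
    functions below it, hence monotone without any measurability. This matters
    because t -> Pi (Lam t u) is not assumed measurable. *)
Lemma le_lower_integral d (T : measurableType d)
    (nu : {measure set T -> \bar R}) (A : set T) (f g : T -> \bar R) :
  (forall x, A x -> 0 <= f x)%E -> (forall x, A x -> f x <= g x)%E ->
  (\int[nu]_(x in A) f x <= \int[nu]_(x in A) g x)%E.
Proof.
move=> f0 fg.
rewrite !ge0_integralE//; last by move=> x Ax; exact: le_trans (f0 _ Ax) (fg _ Ax).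
apply: ereal_sup_le => _ /= [h hf <-]; exists h => // x.
apply: le_trans (hf x) _; rewrite !patchE; case: ifPn => // xA.
by apply: fg; rewrite inE in xA.
Qed.

Definition dyad m : R := 2^-1 ^+ m.

Lemma dyad_gt0 m : 0 < dyad m.
Proof. by rewrite exprn_gt0// invr_gt0. Qed.

Lemma dyad_ge0 m : 0 <= dyad m.
Proof. exact/ltW/dyad_gt0. Qed.

Lemma dyadS m : dyad m.+1 = 2^-1 * dyad m.
Proof. exact: exprS. Qed.

Lemma dyad_le m l : (m <= l)%N -> dyad l <= dyad m.
Proof.
by move=> ml; rewrite ler_wiXn2l ?invr_ge0// invf_le1// ler1n.
Qed.

Lemma dyad_le1 m : dyad m <= 1.
Proof. by have := dyad_le (leq0n m); rewrite [X in _ <= X -> _]expr0. Qed.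

Lemma dyad_lt (e : R) : 0 < e -> exists m, dyad m < e.
Proof.
move=> e0; exists (Num.bound e^-1); rewrite /dyad exprVn.
rewrite invf_plt ?posrE ?exprn_gt0//.
apply: lt_trans (archi_boundP _) _; first by rewrite invr_ge0 ltW.
by rewrite -natrX ltr_nat ltn_expl.
Qed.

Lemma dyad_cover (t : R) : 0 < t <= 1 -> exists m, dyad m.+1 < t <= dyad m.
Proof.
move=> /andP[t0 t1]; have [m0 m0t] := dyad_lt t0.
case: (ex_minnP (ex_intro (fun m => dyad m < t) m0 m0t)) => -[|m] mt minm.
  by move: mt; rewrite [X in X < _]expr0 ltNge t1.
by exists m; rewrite mt leNgt; apply/negP => /minm; rewrite ltnn.
Qed.

Let I m : set R := `]dyad m.+1, dyad m].
Let B m : set R := `[(dyad m)^-1, (dyad m.+1)^-1[.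

Let mI m : measurable (I m). Proof. exact: measurable_itv. Qed.
Let mB m : measurable (B m). Proof. exact: measurable_itv. Qed.

Let mu_I m : mu (I m) = (dyad m.+1)%:E.
Proof.
rewrite lebesgue_measure_itv/= lte_fin ifT; last first.
  by rewrite dyadS gtr_pMl ?dyad_gt0// invf_lt1// ltr1n.
by rewrite -EFinB; congr EFin; rewrite dyadS; lra.
Qed.

Let mu_B m : mu (B m) = (dyad m)^-1%:E.
Proof.
rewrite lebesgue_measure_itv/= lte_fin ifT; last first.
  by rewrite ltf_pV2 ?posrE ?dyad_gt0// dyadS gtr_pMl ?dyad_gt0// invf_lt1// ltr1n.
by rewrite -EFinB; congr EFin; rewrite dyadS invfM invrK; lra.
Qed.

Let integral_step D c A : measurable D -> 0 <= c -> measurable A ->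
  (\int[mu]_(t in D) (c * \1_A t)%:E = c%:E * mu (A `&` D))%E.
Proof.
move=> mD c0 mA; rewrite -(integral_indic mu mD mA).
have Ac : c < 0 -> (fun _ : R => A) c = set0 by rewrite ltNge c0.
exact: (@integralZl_indic _ _ _ mu _ mD (fun _ : R => A) c Ac mA).
Qed.

Let cover_half_line t : 0 < t -> exists m, I m t \/ 1 < t /\ B m t.
Proof.
move=> t0; have [t1|t1] := leP t 1.
  have [|m mt] := @dyad_cover t; first by rewrite t0.
  by exists m; left; rewrite /I/= in_itv.
have [|m /andP[m1 m2]] := @dyad_cover t^-1.
  by rewrite invr_gt0 t0/= invf_le1// ltW.
exists m; right; split=> //; rewrite /B/= in_itv/= -[t]invrK.
rewrite lef_pV2 ?posrE ?invr_gt0 ?dyad_gt0// m2/=.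
by rewrite ltf_pV2 ?posrE ?invr_gt0 ?dyad_gt0.
Qed.

(** On a dyadic interval dt/t has mass at most 1, so a step function with values
    [a m] (near 0) and [b m] (near infinity) is in L^p(dt/t) as soon as the
    sequences are in l^p. *)
Lemma Lp_dtt_lty p a b f D : (1 <= p)%E -> measurable D -> D `<=` [set t | 0 < t] ->
    (forall m, 0 <= a m) -> (forall m, 0 <= b m) ->
    (forall m t, D t -> dyad m.+1 < t <= dyad m -> `|f t| <= a m) ->
    (forall m t, D t -> 1 < t -> (dyad m)^-1 <= t < (dyad m.+1)^-1 ->
      `|f t| <= b m) ->
  ell p a -> ell p b -> (Lp_dtt D p f < +oo)%E.
Proof.
move=> p1 mD D0 a0 b0 fa fb.
case: p p1 => [r|_|//] /=; last first.
  move=> [M aM] [N bN].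
  have M0 : 0 <= M by rewrite (le_trans (a0 0%N)).
  apply: (@le_lt_trans _ _ (Num.max M N)%:E); last exact: ltry.
  apply: ess_sup_ler => t; rewrite lee_fin patchE; case: ifPn => [|_]; last first.
    by rewrite normr0 le_max M0.
  rewrite inE => Dt; rewrite le_max.
  have [m [mt|[t1 mt]]] := cover_half_line (D0 _ Dt).
    by rewrite (le_trans (fa m _ Dt _))// -[_ && _]/(t \in `]_, _]).
  by rewrite orbC (le_trans (fb m _ Dt t1 _))// -[_ && _]/(t \in `[_, _[).
rewrite lee_fin => r1 [M aM] [N bN].
have r0 : 0 <= r by rewrite (le_trans _ r1).
apply: poweR_lty.
(* step function whose values use 1/t at the left end of each interval *)
pose g m t : \bar R := ((a m `^ r / dyad m.+1) * \1_(I m) t)%:E +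
                       ((b m `^ r * dyad m) * \1_(B m) t)%:E.
have ca m : 0 <= a m `^ r / dyad m.+1 by rewrite divr_ge0 ?powR_ge0 ?dyad_ge0.
have cb m : 0 <= b m `^ r * dyad m by rewrite mulr_ge0 ?powR_ge0 ?dyad_ge0.
have g1 m t : (0 <= ((a m `^ r / dyad m.+1) * \1_(I m) t)%:E)%E.
  by rewrite lee_fin mulr_ge0.
have g2 m t : (0 <= ((b m `^ r * dyad m) * \1_(B m) t)%:E)%E.
  by rewrite lee_fin mulr_ge0.
have g0 m t : (0 <= g m t)%E by rewrite adde_ge0.
have mi (c : R) (A : set R) : measurable A ->
    measurable_fun D (EFin \o (fun t => c * \1_A t)).
  by move=> mA; apply/measurable_EFinP; apply: measurable_funM => //;
    exact: measurable_indic.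
have mg m : measurable_fun D (g m) by apply: emeasurable_funD; exact: mi.
have fr t x : D t -> `|f t| <= x -> `|f t| `^ r <= x `^ r.
  by move=> Dt fx; rewrite ge0_ler_powR ?nnegrE// (le_trans _ fx).
have fg t : D t -> ((`|f t| `^ r / t)%:E <= \sum_(m <oo) g m t)%E.
  move=> Dt; have t0 := D0 _ Dt.
  suff [m fgm] : exists m, ((`|f t| `^ r / t)%:E <= g m t)%E.
    apply: (le_trans fgm).
    apply: le_trans (nneseries_lim_ge m.+1 _); last by move=> k _ _; exact: g0.
    rewrite big_mkord big_ord_recr/= leeDr//.
    by apply: sume_ge0 => k _; exact: g0.
  have [m [mt|[t1 mt]]] := cover_half_line t0; exists m.
    have mt' : dyad m.+1 < t <= dyad m by rewrite -[_ && _]/(t \in `]_, _]).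
    apply: le_trans (leeDl _ (g2 m t)); rewrite lee_fin indicE mem_set// mulr1.
    rewrite ler_pM ?powR_ge0 ?invr_ge0 ?(ltW t0)//; first by rewrite fr// fa.
    by rewrite lef_pV2 ?posrE ?dyad_gt0//; case/andP: mt' => /ltW.
  have mt' : (dyad m)^-1 <= t < (dyad m.+1)^-1 by rewrite -[_ && _]/(t \in `[_, _[).
  apply: le_trans (leeDr _ (g1 m t)); rewrite lee_fin indicE mem_set// mulr1.
  rewrite ler_pM ?powR_ge0 ?invr_ge0 ?(ltW t0)//; first by rewrite fr// (fb m).
  by rewrite invf_ple ?posrE ?dyad_gt0//; case/andP: mt'.
apply: (@le_lt_trans _ _ (\int[mu]_(t in D) \sum_(m <oo) g m t)%E).
  apply: le_lower_integral => t Dt; last exact: fg.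
  by rewrite lee_fin divr_ge0 ?powR_ge0// ltW// D0.
rewrite integral_nneseries//.
apply: (@le_lt_trans _ _ (M + N)%:E); last exact: ltry.
have int_indic c A : 0 <= c -> measurable A ->
    (\int[mu]_(t in D) (c * \1_A t)%:E <= c%:E * mu A)%E.
  move=> c0 mA; rewrite integral_step// lee_wpmul2l ?lee_fin//.
  by rewrite le_measure ?inE//; exact: measurableI.
have int_g m : (\int[mu]_(t in D) g m t <= (a m `^ r + b m `^ r)%:E)%E.
  rewrite ge0_integralD//; [|exact: mi|exact: mi].
  rewrite EFinD; apply: leeD; apply: le_trans (int_indic _ _ _ _) _ => //.
  - exact: mI.
  - by rewrite mu_I -EFinM divfK// gt_eqF// dyad_gt0.
  - exact: mB.
  - by rewrite mu_B -EFinM mulfK// gt_eqF// dyad_gt0.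
apply: lime_le.
  by apply: is_cvg_nneseries => m _ _; apply: integral_ge0 => t _; exact: g0.
apply: nearW => n; rewrite big_mkord.
apply: (@le_trans _ _ (\sum_(m < n) (a m `^ r + b m `^ r)%:E)%E).
  by apply: lee_sum => m _; exact: int_g.
by rewrite sumEFin lee_fin big_split/= lerD.
Qed.

(** The reverse estimate: dt/t gives mass at least 1/2 to a dyadic interval. *)
Lemma dyadic_sum_le_integral a f D (r : R) : 1 <= r -> measurable D ->
    `]0, 1] `<=` D -> D `<=` [set t | 0 < t] -> (forall m, 0 <= a m) ->
    (forall m t, dyad m.+1 < t <= dyad m -> a m <= `|f t|) ->
  forall N, ((2^-1 * \sum_(m < N) a m `^ r)%:E <=
             \int[mu]_(t in D) (`|f t| `^ r / t)%:E)%E.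
Proof.
move=> r1 mD D1 D0 a0 af N.
have r0 : 0 <= r by rewrite (le_trans _ r1).
pose g m t := (a m `^ r / dyad m) * \1_(I m) t.
have ca m : 0 <= a m `^ r / dyad m by rewrite divr_ge0 ?powR_ge0 ?dyad_ge0.
have g0 m t : 0 <= g m t by rewrite mulr_ge0.
have ID m : I m `<=` D.
  move=> t It; apply: D1; move: It; rewrite /I/= !in_itv/= => /andP[t0 t1].
  by rewrite (lt_trans _ t0) ?dyad_gt0// (le_trans t1)// dyad_le1.
have g_out m t : ~ I m t -> g m t = 0.
  by move=> Imt; rewrite /g indicE memNset// mulr0.
have I_disj m l t : I m t -> I l t -> m = l.
  rewrite /I/= !in_itv/= => /andP[m1 m2] /andP[l1 l2].
  by case: (ltngtP m l) => // /dyad_le lm; exfalso; lra.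
apply: (@le_trans _ _ (\int[mu]_(t in D) (\sum_(m < N) (g m t)%:E))%E).
  rewrite ge0_integral_sum//; last 2 first.
  - move=> m; apply/measurable_EFinP; apply: measurable_funM => //.
    by apply: measurable_indic; exact: mI.
  - by move=> m t _; rewrite lee_fin.
  rewrite mulr_sumr -sumEFin; apply: lee_sum => m _.
  rewrite (integral_step mD (ca m) (mI m)) setIidl// mu_I -EFinM lee_fin dyadS.
  by rewrite [2^-1 * dyad m]mulrC mulrA divfK ?gt_eqF ?dyad_gt0// mulrC.
apply: le_lower_integral => t Dt; first by rewrite sumEFin lee_fin sumr_ge0.
have t0 : 0 < t := D0 _ Dt.
rewrite sumEFin lee_fin; have [[m It]|nI] := pselect (exists m, I m t); last first.
  rewrite big1 ?divr_ge0 ?powR_ge0 ?(ltW t0)// => m _; apply: g_out => It.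
  by apply: nI; exists m.
apply: (@le_trans _ _ (g m t)).
  have [mN|Nm] := ltnP m N.
    rewrite (bigD1 (Ordinal mN))//= big1 ?addr0// => l; apply: contraNeq => gl.
    apply/eqP/val_inj => /=; apply: (I_disj _ _ t) => //.
    by apply: contrapT => /g_out gl0; rewrite gl0 eqxx in gl.
  rewrite big1// => l _; apply: g_out => Il.
  by move: Nm; rewrite (I_disj _ _ _ It Il) leqNgt ltn_ord.
have /andP[t1 t2] : dyad m.+1 < t <= dyad m by rewrite -[_ && _]/(t \in `]_, _]).
rewrite /g indicE mem_set// mulr1 ler_pM ?powR_ge0 ?invr_ge0 ?dyad_ge0//.
  by rewrite ge0_ler_powR ?nnegrE// af// t1.
by rewrite lef_pV2 ?posrE ?dyad_gt0.
Qed.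

Lemma le_ess_sup_dyadic a f D : `]0, 1] `<=` D ->
    (forall m t, dyad m.+1 < t <= dyad m -> a m <= `|f t|) ->
  forall m, ((a m)%:E <= Lp_dtt D +oo f)%E.
Proof.
move=> D1 af m; rewrite /Lp_dtt; set M := ess_sup _ _.
rewrite leNgt; apply/negP => Mam.
have [A [mA A0 fA]] := ess_sup_ge mu (fun t => `|(f \_ D) t|%:E).
have : (mu (I m) <= mu A)%E.
  apply: le_measure => [||t It]; [by rewrite inE; exact: mI|by rewrite inE|].
  apply: fA => /=; apply/negP.
  rewrite -ltNge (lt_le_trans Mam)// lee_fin patchE mem_set; last first.
    apply: D1; move: It; rewrite /I/= !in_itv/= => /andP[t0 t1].
    by rewrite (lt_trans _ t0) ?dyad_gt0// (le_trans t1)// dyad_le1.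
  by apply: af; rewrite -[_ && _]/(t \in `]_, _]).
by rewrite mu_I A0 lee_fin leNgt dyad_gt0.
Qed.

Lemma ell_of_Lp_dtt p a f D : (1 <= p)%E -> measurable D -> `]0, 1] `<=` D ->
    D `<=` [set t | 0 < t] -> (forall m, 0 <= a m) ->
    (forall m t, dyad m.+1 < t <= dyad m -> a m <= `|f t|) ->
  (Lp_dtt D p f < +oo)%E -> ell p a.
Proof.
move=> p1 mD D1 D0 a0 af; case: p p1 => [r|_|//]; last first.
  move=> Moo; have := le_ess_sup_dyadic D1 af; move: Moo.
  case: (Lp_dtt D +oo f) => [M| |]//= _ aM; first by exists M => m; rewrite -lee_fin.
  by exists 0 => m; have := aM m.
rewrite lee_fin => r1 /= Ioo.
have r0 : r^-1 != 0 by rewrite invr_neq0// gt_eqF// (lt_le_trans _ r1).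
have := dyadic_sum_le_integral r1 mD D1 D0 a0 af; move: (lty_poweRy r0 Ioo).
case: (\int[mu]_(t in D) _)%E => [M| |]//= _ aM; last by have := aM 0%N.
exists (2 * M) => N; have := aM N.
by rewrite lee_fin -(ler_pM2l (@ltr0n R 2))// mulrA divff// mul1r.
Qed.

(** A quantitative form of the previous lemma: the constant does not depend on
    the function, as needed for the boundedness of the extended projections. *)
Lemma le_Lp_dtt_dyadic p a f D : (1 <= p)%E -> measurable D -> `]0, 1] `<=` D ->
    D `<=` [set t | 0 < t] -> (forall m, 0 <= a m) ->
    (forall m t, dyad m.+1 < t <= dyad m -> a m <= `|f t|) ->
  forall m, ((a m)%:E <= 2%:E * Lp_dtt D p f)%E.
Proof.
move=> p1 mD D1 D0 a0 af m; case: p p1 => [r|_|//]; last first.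
  apply: (le_trans (le_ess_sup_dyadic D1 af m)); rewrite lee_pemull ?lee_fin ?ler1n//.
  by apply: le_trans (le_ess_sup_dyadic D1 af 0%N); rewrite lee_fin.
rewrite lee_fin => r1 /=.
have r0 : 0 < r by rewrite (lt_le_trans _ r1).
set J := (\int[mu]_(t in D) _)%E.
have J0 : (0 <= J)%E.
  by apply: integral_ge0 => t Dt; rewrite lee_fin divr_ge0 ?powR_ge0// ltW// D0.
have aJ : ((a m `^ r)%:E <= 2%:E * J)%E.
  have := dyadic_sum_le_integral r1 mD D1 D0 a0 af m.+1.
  rewrite -/J -(@lee_pmul2l _ 2%:E) ?lte_fin// -EFinM mulVKf//.
  apply: le_trans; rewrite lee_fin big_ord_recr/= lerDr.
  by apply: sumr_ge0 => j _; exact: powR_ge0.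
have -> : (a m)%:E = ((a m `^ r)%:E `^ r^-1)%E.
  by rewrite poweR_EFin -powRrM divff ?gt_eqF// powRr1.
apply: (@le_trans _ _ ((2%:E * J) `^ r^-1)%E).
  apply: gt0_ler_poweR; rewrite ?invr_ge0 ?(ltW r0)//.
  - by rewrite in_itv/= lee_fin powR_ge0 leey.
  - by rewrite in_itv/= mule_ge0// leey.
rewrite poweRM// lee_wpmul2r ?poweR_ge0// poweR_EFin lee_fin.
by rewrite ler1_powR ?ler1n// invf_le1.
Qed.

End DyadicIntegrals.
Arguments dyad {R} m.

(** * Real-valued norms and the K functional *)

Section RealNorm.
Context {R : realType} {k : scalar_kind}.
Implicit Types (X Y : normedModType (scalars R k)).

Lemma scalar_re_le (x y : scalars R k) : x <= y -> scalar_re x <= scalar_re y.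
Proof. by case: k x y => //= x y; rewrite lecE => /andP[]. Qed.

Lemma scalar_re0 : scalar_re (0 : scalars R k) = 0.
Proof. by case: k. Qed.

Lemma scalar_re_ge0 (x : scalars R k) : 0 <= x -> 0 <= scalar_re x.
Proof. by move/scalar_re_le; rewrite scalar_re0. Qed.

Lemma scalar_re_gt0 (x : scalars R k) : 0 < x -> 0 < scalar_re x.
Proof. by case: k x => //= x; rewrite ltcE => /andP[]. Qed.

Lemma scalar_reD (x y : scalars R k) :
  scalar_re (x + y) = scalar_re x + scalar_re y.
Proof. by case: k x y => //= -[x1 x2] [y1 y2]. Qed.

Lemma scalar_re_ge0M (x y : scalars R k) : 0 <= x -> 0 <= y ->
  scalar_re (x * y) = scalar_re x * scalar_re y.
Proof.
case: k x y => //= -[x1 x2] [y1 y2]; rewrite !lecE/=.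
by move=> /andP[/eqP-> _] /andP[/eqP-> _]; rewrite mulr0 subr0.
Qed.

Lemma ltr_scalar_re (x y : scalars R k) : 0 <= x -> 0 <= y ->
  (x < y) = (scalar_re x < scalar_re y).
Proof.
case: k x y => //= -[x1 x2] [y1 y2]; rewrite !lecE ltcE/=.
by move=> /andP[/eqP-> _] /andP[/eqP-> _]; rewrite eqxx.
Qed.

Lemma scalar_re_onto_gt0 (e : R) : 0 < e ->
  exists2 x : scalars R k, 0 < x & scalar_re x = e.
Proof.
case: k => e0; first by exists e.
by exists (e%:C)%C => //=; rewrite ltcE/= eqxx.
Qed.

Lemma rnorm0 X : rnorm (0 : X) = 0.
Proof. by rewrite /rnorm normr0 scalar_re0. Qed.

Lemma rnorm_ge0 X (x : X) : 0 <= rnorm x.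
Proof. exact: scalar_re_ge0. Qed.

Lemma rnormN X (x : X) : rnorm (- x) = rnorm x.
Proof. by rewrite /rnorm normrN. Qed.

Lemma rnormB X (x y : X) : rnorm (x - y) = rnorm (y - x).
Proof. by rewrite -rnormN opprB. Qed.

Lemma ler_rnormD X (x y : X) : rnorm (x + y) <= rnorm x + rnorm y.
Proof. by rewrite /rnorm -scalar_reD scalar_re_le// ler_normD. Qed.

Lemma ler_rnormB X (x y : X) : rnorm (x - y) <= rnorm x + rnorm y.
Proof. by rewrite -(rnormN y) ler_rnormD. Qed.

Lemma ler_rnorm_dist X (x y z : X) : rnorm (x - z) <= rnorm (x - y) + rnorm (y - z).
Proof. by apply: le_trans (ler_rnormD _ _); rewrite addrA subrK. Qed.

Lemma rnorm_eq0 X (x : X) : rnorm x = 0 -> x = 0.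
Proof.
move=> x0; apply/eqP; rewrite -normr_eq0 eq_le normr_ge0 andbT.
rewrite -[_ <= _]negbK -real_ltNge ?ltr_scalar_re ?realE ?lexx ?normr_ge0//.
by rewrite -/(rnorm x) x0 -(rnorm0 X) /rnorm normr0 ltxx.
Qed.

Lemma continuous_linear_rnorm X Y (f : {linear X -> Y}) : continuous f ->
  exists2 M, 0 <= M & forall x, rnorm (f x) <= M * rnorm x.
Proof.
move=> fc; have [M [Mreal fM]] : \forall r \near +oo, forall x, `|f x| <= r * `|x|.
  exact/linear_boundedP/continuous_linear_bounded/fc.
have M1 : 0 <= `|M| + 1 by rewrite addr_ge0.
exists (scalar_re (`|M| + 1)).
  exact: scalar_re_ge0.
move=> x; rewrite /rnorm -scalar_re_ge0M//; apply: scalar_re_le; apply: fM.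
by rewrite (le_lt_trans (real_ler_norm Mreal))// ltrDl.
Qed.

(** Convergence at 0 from the right with real tolerances and dyadic
    neighbourhoods, uniformly for real and complex scalars. *)
Lemma cvg_at0_dyadic Y (f : R -> Y) (y : Y) :
  f t @[t --> 0^'+] --> y <->
  forall e, 0 < e -> exists m, forall t, 0 < t <= dyad m -> rnorm (y - f t) < e.
Proof.
rewrite cvgrPdist_lt; split => [fy e e0|fy e e0].
  have [x x0 xe] := scalar_re_onto_gt0 e0.
  have [d /= d0 fd] := fy x x0; have [m md] := dyad_lt d0.
  exists m => t /andP[t0 tm]; rewrite -xe -ltr_scalar_re ?normr_ge0 ?(ltW x0)//.
  apply: fd => //=; rewrite sub0r normrN gtr0_norm//; exact: le_lt_trans md.
have [m fm] := fy _ (scalar_re_gt0 e0).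
near=> t; rewrite ltr_scalar_re ?normr_ge0 ?(ltW e0)//; apply: fm; apply/andP; split.
  by near: t; exact: nbhs_right_gt.
by near: t; apply: nbhs_right_le; exact: dyad_gt0.
Unshelve. all: by end_near. Qed.

End RealNorm.

Section KFunctional.
Context {R : realType} {k : scalar_kind}.
Context {X0 X1 : completeNormedModType (scalars R k)} (i : {linear X1 -> X0}).
Implicit Types (Z : set X1) (t : R) (u : X0) (w : X1).

Lemma Kfun_le Z t u0 w : 0 <= t -> Z w ->
  Kfun i Z t (u0 + i w) <= rnorm u0 + t * rnorm w.
Proof.
move=> t0 Zw; apply: ge_inf; last by exists u0, w.
exists 0 => _ [v0 [v1 [_ _ ->]]].
by rewrite addr_ge0 ?mulr_ge0 ?rnorm_ge0.
Qed.

Lemma le_Kfun Z t u (x : R) : Z 0 ->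
    (forall u0 w, Z w -> u = u0 + i w -> x <= rnorm u0 + t * rnorm w) ->
  x <= Kfun i Z t u.
Proof.
move=> Z0 xle; apply: lb_le_inf => [|_ [u0 [u1 [Zu1 uE ->]]]]; last exact: xle.
by exists (rnorm u + t * rnorm (0 : X1)), u, 0; split; rewrite ?raddf0 ?addr0.
Qed.

Lemma Kfun_ge0 Z t u : Z 0 -> 0 <= t -> 0 <= Kfun i Z t u.
Proof.
by move=> Z0 t0; apply: le_Kfun => // *; rewrite addr_ge0 ?mulr_ge0 ?rnorm_ge0.
Qed.

Lemma Kfun_le_rnorm Z t u : Z 0 -> 0 <= t -> Kfun i Z t u <= rnorm u.
Proof.
move=> Z0 t0; have := Kfun_le u t0 Z0.
by rewrite raddf0 addr0 rnorm0 mulr0 addr0.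
Qed.

Lemma Kfun_mono Z s t u : Z 0 -> 0 <= s <= t -> Kfun i Z s u <= Kfun i Z t u.
Proof.
move=> Z0 /andP[s0 st]; apply: le_Kfun => // u0 u1 Zu1 ->.
by rewrite (le_trans (Kfun_le _ s0 Zu1))// lerD2l ler_wpM2r ?rnorm_ge0.
Qed.

(** A form of the monotonicity of K(t,u)/t, sufficient for dyadic sampling. *)
Lemma Kfun_double Z t u : Z 0 -> 0 <= t ->
  Kfun i Z (2 * t) u <= 2 * Kfun i Z t u.
Proof.
move=> Z0 t0; rewrite -ler_pdivrMl//; apply: le_Kfun => // u0 u1 Zu1 ->.
rewrite ler_pdivrMl//; apply: le_trans (Kfun_le _ _ Zu1) _; first by rewrite mulr_ge0.
by rewrite mulrDr mulrA lerD2r ler_peMl ?rnorm_ge0// ler1n.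
Qed.

Lemma Kfun_subset Z Z' t u : Z 0 -> Z `<=` Z' -> 0 <= t ->
  Kfun i Z' t u <= Kfun i Z t u.
Proof.
move=> Z0 ZZ' t0; apply: le_Kfun => // u0 u1 Zu1 ->.
exact: Kfun_le t0 (ZZ' _ Zu1).
Qed.

Lemma NJ_le Z t w v : 0 <= t -> Z v -> NJ i Z t w <= Jfun i t (w - v).
Proof.
move=> t0 Zv; apply: ge_inf; last by exists v.
exists 0 => _ [v' _ ->].
by rewrite addr_ge0 ?mulr_ge0 ?rnorm_ge0.
Qed.

Lemma NJ_ge Z t w (x : R) : Z 0 -> (forall v, Z v -> x <= Jfun i t (w - v)) ->
  x <= NJ i Z t w.
Proof.
move=> Z0 xle; apply: lb_le_inf => [|_ [v Zv ->]]; last exact: xle.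
by exists (Jfun i t (w - 0)), 0.
Qed.

End KFunctional.

Section Powers.
Context {R : realType}.

(** The ratio of the geometric sequence [dyad m `^ x]. *)
Definition half_pow (x : R) : R := 2^-1 `^ x.

Lemma half_pow_gt0 x : 0 < half_pow x.
Proof. by rewrite powR_gt0// invr_gt0. Qed.

Lemma half_pow_lt1 x : 0 < x -> 0 < half_pow x < 1.
Proof.
move=> x0; rewrite half_pow_gt0/= -[ltRHS](congr1 (@^~ x) (powR1 R)).
by apply: gt0_ltr_powR; rewrite ?nnegrE ?invr_ge0// invf_lt1// ltr1n.
Qed.

Lemma dyad_powR m (x : R) : dyad m `^ x = half_pow x ^+ m.
Proof.
elim: m => [|m IH]; first by rewrite /dyad !expr0 powR1.
by rewrite dyadS powRM ?dyad_ge0// IH exprS.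
Qed.

Lemma dyad_powR_gt0 m (x : R) : 0 < dyad m `^ x.
Proof. by rewrite powR_gt0// dyad_gt0. Qed.

Lemma dyad_powRD m (x y : R) : dyad m `^ (x + y) = dyad m `^ x * dyad m `^ y.
Proof. by rewrite powRD// (gt_eqF (dyad_gt0 m)) implybT. Qed.

Lemma half_pow_ge_half x : x <= 1 -> 2^-1 <= half_pow x.
Proof.
move=> x1; rewrite -[leLHS]powRr1 ?invr_ge0//.
by rewrite ger_powR// invr_gt0 ltr0n/= invf_le1// ler1n.
Qed.

Lemma ler_powRN (s t x : R) : 0 < s -> s <= t -> 0 <= x ->
  t `^ (- x) <= s `^ (- x).
Proof.
move=> s0 st x0; have t0 : 0 < t by exact: lt_le_trans st.
rewrite !powRN lef_pV2 ?posrE ?powR_gt0//.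
by rewrite ge0_ler_powR ?nnegrE// ltW.
Qed.

End Powers.

(** * Interpolation spaces as sequence spaces *)

Section Discretisation.
Context {R : realType} {k : scalar_kind}.
Context {X0 X1 : completeNormedModType (scalars R k)} (i : {linear X1 -> X0}).
Context (theta : R) (p : \bar R) (theta01 : 0 < theta < 1) (p1 : (1 <= p)%E).
Implicit Types (Z : set X1) (u : X0).

Definition Kdyad Z u m : R := dyad m `^ (- theta) * Kfun i Z (dyad m) u.

Lemma Kdyad_ge0 Z u m : Z 0 -> 0 <= Kdyad Z u m.
Proof. by move=> Z0; rewrite mulr_ge0 ?powR_ge0 ?Kfun_ge0 ?dyad_ge0. Qed.

Lemma norm_interp_integrand Z u t : Z 0 -> 0 <= t ->
  `|t `^ (- theta) * Kfun i Z t u| = t `^ (- theta) * Kfun i Z t u.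
Proof. by move=> Z0 t0; rewrite ger0_norm// mulr_ge0 ?powR_ge0 ?Kfun_ge0. Qed.

Lemma half_Kdyad_le Z u m t : Z 0 -> dyad m.+1 < t <= dyad m ->
  2^-1 * Kdyad Z u m <= `|t `^ (- theta) * Kfun i Z t u|.
Proof.
move=> Z0 /andP[t1 t2]; have t0 : 0 < t := lt_trans (dyad_gt0 _) t1.
have /andP[th0 _] := theta01.
rewrite /Kdyad norm_interp_integrand ?(ltW t0)// mulrCA ler_pM ?powR_ge0//.
- by rewrite mulr_ge0 ?invr_ge0 ?Kfun_ge0 ?dyad_ge0.
- by rewrite ler_powRN// ltW.
rewrite ler_pdivrMl//; apply: (le_trans _ (Kfun_double _ _ Z0 (ltW t0))).
apply: Kfun_mono => //; rewrite dyad_ge0 /= -ler_pdivrMl//.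
by rewrite -dyadS ltW.
Qed.

Let half_line_gt0 : `]0, +oo[ `<=` [set t : R | 0 < t].
Proof. by move=> t /=; rewrite in_itv/= andbT. Qed.

Let unit_half_line : `]0, 1] `<=` (`]0, +oo[ : set R).
Proof. by move=> t /=; rewrite !in_itv/= andbT => /andP[]. Qed.

(** K is comparable to a constant on each dyadic interval of ]0, 1], and bounded
    by ||u|| on [1, +oo[, where t^(-theta) is in L^p(dt/t). *)
Lemma interp_spaceP Z u : Z 0 ->
  interp_space i Z theta p u <-> ell p (Kdyad Z u).
Proof.
move=> Z0; have /andP[th0 th1] := theta01.
have K0 m := Kdyad_ge0 u m Z0.
split => [uE|uE].
  have a0 m : 0 <= 2^-1 * Kdyad Z u m by rewrite mulr_ge0 ?invr_ge0.
  have := @ell_of_Lp_dtt R p (fun m => 2^-1 * Kdyad Z u m) _ _ p1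
    (measurable_itv _) unit_half_line half_line_gt0 a0 
    (fun m t => half_Kdyad_le u Z0) uE.
  move/(ell_scale p1 (ler0n _ 2) a0); apply: ell_le => // m.
  by rewrite K0 mulrA divff// mul1r lexx.
have q01 : 0 <= half_pow theta < 1.
  by have /andP[/ltW -> ->] := half_pow_lt1 th0.
apply: (@Lp_dtt_lty R p (fun m => 2 * Kdyad Z u m)
         (fun m => rnorm u * half_pow theta ^+ m)) => //.
- by move=> m; rewrite mulr_ge0.
- by move=> m; rewrite mulr_ge0 ?rnorm_ge0// exprn_ge0// ltW// half_pow_gt0.
- move=> m t _ /andP[t1 t2]; have t0 : 0 < t := lt_trans (dyad_gt0 _) t1.
  rewrite norm_interp_integrand ?(ltW t0)// mulrA ler_pM ?powR_ge0 ?Kfun_ge0 ?(ltW t0)//.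
    apply: (le_trans (ler_powRN (dyad_gt0 _) (ltW t1) (ltW th0))).
    rewrite dyadS powRM ?invr_ge0 ?dyad_ge0// ler_wpM2r ?powR_ge0//.
    by rewrite powRN invf_ple ?posrE ?half_pow_gt0// half_pow_ge_half// ltW.
  by rewrite Kfun_mono// (ltW t0).
- move=> m t _ _ /andP[t1 _].
  have t0 : 0 < t by apply: lt_le_trans t1; rewrite invr_gt0 dyad_gt0.
  rewrite norm_interp_integrand ?(ltW t0)// mulrC ler_pM ?powR_ge0 ?Kfun_ge0 ?(ltW t0)//.
    by rewrite Kfun_le_rnorm// ltW.
  have d0 : 0 < (dyad m : R)^-1 by rewrite invr_gt0 dyad_gt0.
  apply: (le_trans (ler_powRN d0 t1 (ltW th0))).
  by rewrite -powR_inv1 ?dyad_ge0// -powRrM mulrNN mul1r dyad_powR.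
- by apply: ell_scale.
- by apply: ell_geometric => //; exact: rnorm_ge0.
Qed.

(** The embedding of [X_0, Z]_{theta,p} in [X_0, Z]_{theta,oo}. *)
Lemma Kdyad_le_interp_norm Z u m : Z 0 ->
  ((Kdyad Z u m)%:E <= 4%:E * interp_norm i Z theta p u)%E.
Proof.
move=> Z0; have K0 l := Kdyad_ge0 u l Z0.
have a0 l : 0 <= 2^-1 * Kdyad Z u l by rewrite mulr_ge0 ?invr_ge0.
have := @le_Lp_dtt_dyadic R p (fun m => 2^-1 * Kdyad Z u m) _ _ p1
    (measurable_itv _) unit_half_line half_line_gt0 a0 
    (fun m t => half_Kdyad_le u Z0) m.
rewrite -(@lee_pmul2l _ 2%:E)// -EFinM mulrA divff// mul1r => /le_trans; apply.
by rewrite muleA -EFinM -natrM.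
Qed.

End Discretisation.

(** ** Limits at 0 of functions with geometric increments *)

Section DyadicLimit.
Context {R : realType} {k : scalar_kind} {Y : completeNormedModType (scalars R k)}.
Context (f : R -> Y) (B q : R) (B0 : 0 <= B) (q01 : 0 < q < 1).
Context (f_diff : forall m t, dyad m.+1 <= t <= dyad m ->
  rnorm (f t - f (dyad m)) <= B * q ^+ m).

(** Telescoping over the dyadic points between t and [dyad m]. *)
Lemma dyadic_oscillation m t : 0 < t <= dyad m ->
  rnorm (f t - f (dyad m)) <= B / (1 - q) * q ^+ m.
Proof.
move=> /andP[t0 tm]; have /andP[q0 q1] := q01.
have q1' : 0 < 1 - q by lra.
have [|l /andP[l1 l2]] := @dyad_cover R t; first by rewrite t0 (le_trans tm)// dyad_le1.
have ml : (m <= l)%N.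
  rewrite leqNgt; apply/negP => /(@dyad_le R) lm.
  by have := lt_le_trans l1 tm; rewrite ltNge lm.
(* the right-hand side telescopes: B q^l = B / (1 - q) (q^l - q^(l+1)) *)
have geo j : rnorm (f (dyad (m + j)%N) - f (dyad m)) <=
    B / (1 - q) * (q ^+ m - q ^+ (m + j)).
  elim: j => [|j IH]; first by rewrite addn0 !subrr rnorm0 mulr0.
  apply: (le_trans (ler_rnorm_dist _ (f (dyad (m + j)%N)) _)).
  rewrite addnS; have := f_diff (m := m + j) (t := dyad (m + j).+1).
  rewrite lexx dyad_le// => /(_ isT) fj; apply: (le_trans (lerD fj IH)).
  by rewrite exprS le_eqVlt; apply/orP; left; apply/eqP; field; rewrite gt_eqF.
apply: (le_trans (ler_rnorm_dist _ (f (dyad l)) _)).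
have := f_diff (m := l) (t := t); rewrite (ltW l1) l2 => /(_ isT) fl.
have := geo (l - m)%N; rewrite subnKC// => gl.
apply: (le_trans (lerD fl gl)); rewrite mulrBr addrCA gerDl subr_le0.
rewrite ler_wpM2r ?exprn_ge0 ?(ltW q0)// ler_pdivlMr// ler_piMr// lerBlDr lerDl.
exact: ltW.
Qed.

Lemma dyadic_limit_cvg : cvg (f t @[t --> 0^'+]).
Proof.
have /andP[q0 q1] := q01; have q1' : 0 < 1 - q by lra.
apply: cauchy_cvg; apply: cauchy_exP => e e0.
have e0' := scalar_re_gt0 e0.
have C0 : 0 <= B / (1 - q) by rewrite divr_ge0// ltW.
have [m qm] : exists m, B / (1 - q) * q ^+ m < scalar_re e.
  have := @cvg_geometric _ (B / (1 - q)) q; rewrite gtr0_norm// => /(_ q1).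
  move=> /cvgrPdist_lt /(_ _ e0') [m _ qm]; exists m.
  have /= := qm m (leqnn m); rewrite sub0r normrN ger0_norm//.
  by rewrite mulr_ge0 ?exprn_ge0 ?(ltW q0).
exists (f (dyad m)).
suff : \forall t \near 0^'+, ball (f (dyad m)) e (f t) by [].
near=> t; rewrite -ball_normE/= ltr_scalar_re ?normr_ge0 ?(ltW e0)//.
rewrite -/(rnorm _) rnormB (le_lt_trans _ qm)// dyadic_oscillation//.
apply/andP; split; first by near: t; exact: nbhs_right_gt.
by near: t; apply: nbhs_right_le; exact: dyad_gt0.
Unshelve. all: by end_near. Qed.

Lemma dyadic_limit_le y : f t @[t --> 0^'+] --> y ->
  rnorm y <= rnorm (f 1) + B / (1 - q).
Proof.
move=> /cvg_at0_dyadic fy; apply/ler_addgt0Pr => e e0.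
have [m fm] := fy _ e0; have := fm (dyad m); rewrite dyad_gt0 lexx => /(_ isT) fye.
have := @dyadic_oscillation 0 (dyad m); rewrite dyad_gt0 dyad_le// => /(_ isT).
rewrite [dyad 0]expr0 expr0 mulr1 => f1.
have -> : y = (y - f (dyad m)) + ((f (dyad m) - f 1) + f 1) by rewrite !subrK.
apply: (le_trans (ler_rnormD _ _)); apply: (le_trans (lerD (ltW fye) (ler_rnormD _ _))).
by rewrite addrC; apply: lerD => //; rewrite addrC lerD2l.
Qed.

End DyadicLimit.

(** * Consequences of linearisability *)

Section LinearisableCouple.
Context {R : realType} {k : scalar_kind}.
Context {X0 X1 : completeNormedModType (scalars R k)}.
Context (i : {linear X1 -> X0}) (Lam : R -> {linear X0 -> X1}).
Context (i_cont : continuous i) (lin : linearisable i Lam).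
Local Notation K := (Kfun i setT).

Lemma linearisation_error : exists2 C, 0 < C & forall t u, 0 < t <= 1 ->
  rnorm (u - i (Lam t u)) + t * rnorm (Lam t u) <= C * K t u.
Proof.
case: lin => C1 [C2 [_ C20 LamK]]; exists C2 => // t u t01.
by have /andP[] := LamK t u t01.
Qed.

(** Both Lam t u and Lam s u approximate u, so u cancels in their difference. *)
Lemma Jfun_linearisation_diff : exists2 C, 0 <= C & forall s t u,
    0 < t <= s -> s <= 1 -> Jfun i t (Lam t u - Lam s u) <= C * K s u.
Proof.
have [C C0 LamK] := linearisation_error; exists (2 * C) => [|s t u /andP[t0 ts] s1].
  by rewrite mulr_ge0// ltW.
have s0 : 0 < s := lt_le_trans t0 ts.
have t1 : t <= 1 := le_trans ts s1.
have := LamK t u; rewrite t0 t1 => /(_ isT) Lt.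
have := LamK s u; rewrite s0 s1 => /(_ isT) Ls.
have Kts : C * K t u <= C * K s u.
  by rewrite ler_wpM2l ?(ltW C0)// Kfun_mono// (ltW t0).
have h0 : rnorm (i (Lam t u - Lam s u)) <=
    rnorm (u - i (Lam t u)) + rnorm (u - i (Lam s u)).
  rewrite raddfB/= -[i (Lam t u) - _](subrKA u) (le_trans (ler_rnormD _ _))//.
  by rewrite [rnorm (_ - u)]rnormB.
have h1 : t * rnorm (Lam t u - Lam s u) <=
    t * rnorm (Lam t u) + s * rnorm (Lam s u).
  rewrite (le_trans (ler_wpM2l (ltW t0) (ler_rnormB _ _)))// mulrDr lerD2l.
  by rewrite ler_wpM2r ?rnorm_ge0.
by rewrite /Jfun; lra.
Qed.

(** With v in Z, decompose u = (u - i v) + i v and compare v with Lam t u. *)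
Lemma Kfun_intersection_le (Z : set X1) : Z 0 ->
  exists2 C, 0 <= C & forall t u, 0 < t <= 1 ->
    Kfun i Z t u <= C * K t u + NJ i Z t (Lam t u).
Proof.
move=> Z0; have [C C0 LamK] := linearisation_error.
exists C => [|t u t01]; first exact: ltW.
have /andP[t0 t1] := t01; rewrite addrC -lerBlDr; apply: NJ_ge => // v Zv.
rewrite lerBlDr addrC.
have := Kfun_le i (u - i v) (ltW t0) Zv; rewrite subrK => /le_trans; apply.
have := LamK t u t01.
have : rnorm (u - i v) <= rnorm (u - i (Lam t u)) + rnorm (i (Lam t u - v)).
  by rewrite raddfB; exact: ler_rnorm_dist.
have : t * rnorm v <= t * rnorm (Lam t u) + t * rnorm (Lam t u - v).
  rewrite -mulrDr ler_wpM2l ?(ltW t0)// -[v in X in X <= _](subKr (Lam t u)).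
  exact: ler_rnormB.
by rewrite /Jfun; lra.
Qed.

(** With u = u0 + w and w in Z, the vector w is a competitor in the infimum
    defining the quotient norm of Lam t u. *)
Lemma NJ_linearisation_le (Z : set X1) : Z 0 ->
  exists2 C, 0 <= C & forall t u, 0 < t <= 1 ->
    NJ i Z t (Lam t u) <= C * Kfun i Z t u.
Proof.
move=> Z0; have [C C0 LamK] := linearisation_error.
exists (C + 1) => [|t u t01]; first by rewrite addr_ge0// ltW.
have /andP[t0 t1] := t01.
have KZ : C * K t u <= C * Kfun i Z t u.
  by rewrite ler_wpM2l ?(ltW C0)// Kfun_subset// ltW.
rewrite mulrDl mul1r -lerBlDl; apply: le_Kfun => // u0 w Zw uE.
rewrite lerBlDl; apply: (le_trans (NJ_le i (Lam t u) (ltW t0) Zw)).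
have h0 : rnorm (i (Lam t u - w)) <= rnorm (u - i (Lam t u)) + rnorm u0.
  have -> : u0 = u - i w by rewrite uE addrK.
  rewrite raddfB [rnorm (u - i (Lam t u))]rnormB; exact: ler_rnorm_dist.
have h1 : t * rnorm (Lam t u - w) <= t * rnorm (Lam t u) + t * rnorm w.
  by rewrite -mulrDr ler_wpM2l ?(ltW t0)// ler_rnormB.
have := LamK t u t01; rewrite /Jfun; lra.
Qed.

Section OneSubspace.
Context (Z : set X1) (th : R) (Y : completeNormedModType (scalars R k)).
Context (Pi : {linear X1 -> Y}) (th01 : 0 < th < 1).
Context (order : interpolation_order i Lam Z th Pi).

Let Z0 : Z 0. Proof. by case: order => PiZ _; apply/PiZ; rewrite raddf0. Qed.

(** The basic estimate: the order of Z bounds t^th ||Pi w|| by the quotient norm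
    of w = Lam t u - Lam s u, hence by J(t, w), hence by K. *)
Lemma Pi_linearisation_diff : exists2 C, 0 <= C & forall m t u,
  dyad m.+1 <= t <= dyad m ->
  rnorm (Pi (Lam t u) - Pi (Lam (dyad m) u)) <=
    C * (dyad m `^ (- th) * K (dyad m) u).
Proof.
have [_ ord] := order.
have [|C1 [C2 [_ C20 PiN]]] := ord 2; first by rewrite ler1n.
have [C C0 LamJ] := Jfun_linearisation_diff.
exists (2 * (C2 * C)) => [|m t u /andP[t1 t2]]; first by rewrite !mulr_ge0// ltW.
have /andP[th0 th1] := th01.
have t0 : 0 < t := lt_le_trans (dyad_gt0 _) t1.
have tle1 : t <= 1 := le_trans t2 (dyad_le1 m).
(* linearity of Lam s turns the sum in the definition into a difference *)
have := PiN (dyad m) t u (- u); rewrite dyad_gt0 dyad_le1 t0 tle1 -dyadS t1.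
rewrite (le_trans t2) ?ler_peMl ?dyad_ge0 ?ler1n// => /(_ isT isT isT) /andP[_].
set w := Lam t u + _; have wE : w = Lam t u - Lam (dyad m) u by rewrite /w raddfN.
move=> Pw; rewrite -raddfB -wE.
have Jw : C2 * NJ i Z t w <= C2 * (C * K (dyad m) u).
  rewrite ler_wpM2l ?(ltW C20)//.
  apply: (le_trans (NJ_le i w (ltW t0) Z0)); rewrite subr0 wE.
  by apply: LamJ; rewrite ?dyad_le1// t0.
have half_le : 2^-1 * dyad m `^ th <= t `^ th.
  apply: (@le_trans _ _ (dyad m.+1 `^ th)).
    rewrite dyadS powRM ?invr_ge0 ?dyad_ge0// ler_wpM2r ?powR_ge0//.
    exact/half_pow_ge_half/ltW.
  by rewrite ge0_ler_powR ?nnegrE ?dyad_ge0// ltW.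
have := le_trans (ler_wpM2r (rnorm_ge0 (Pi w)) half_le) (le_trans Pw Jw).
rewrite mulrAC -ler_pdivlMr ?dyad_powR_gt0// powRN => h.
rewrite [leRHS](_ : _ = 2 * (C2 * (C * K (dyad m) u) / dyad m `^ th)); last by ring.
by rewrite -ler_pdivrMl.
Qed.

(** The starting point of the telescoping sum. At t = 1 the J norm is equivalent
    to the norm of X_1, because the inclusion in X_0 is bounded. *)
Lemma Pi_linearisation_one : exists2 C, 0 <= C & forall u,
  rnorm (Pi (Lam 1 u)) <= C * K 1 u.
Proof.
have [_ ord] := order; have [//|C1 [C2 [_ C20 PiN]]] := ord 1.
have [C C0 LamK] := linearisation_error.
have [M M0 iM] := continuous_linear_rnorm i_cont.
exists (C2 * ((M + 1) * C)) => [|u].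
  by rewrite mulr_ge0 ?(ltW C20)// mulr_ge0 ?(ltW C0)// addr_ge0.
have := PiN 1 1 u 0; rewrite !raddf0 addr0 ltr01 lexx invr1 !mul1r lexx.
move=> /(_ isT isT isT) /andP[_]; rewrite powR1 mul1r => /le_trans; apply.
rewrite -mulrA ler_wpM2l ?(ltW C20)//.
apply: (le_trans (NJ_le i (Lam 1 u) ler01 Z0)); rewrite subr0 /Jfun mul1r -mulrA.
have := LamK 1 u; rewrite ltr01 lexx mul1r => /(_ isT) /(ler_wpM2l _) h.
apply: (le_trans _ (h (M + 1) _)); last by rewrite addr_ge0.
have := iM (Lam 1 u); have := rnorm_ge0 (u - i (Lam 1 u)).
have := rnorm_ge0 (Lam 1 u); move: (rnorm _) (rnorm _) (rnorm _) => x y z *.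
rewrite mulrDl mul1r mulrDr; nra.
Qed.

End OneSubspace.
End LinearisableCouple.

(** * The behaviour of one projection *)

Section OneProjection.
Context {R : realType} {k : scalar_kind}.
Context {X0 X1 : completeNormedModType (scalars R k)}.
Context (i : {linear X1 -> X0}) (Lam : R -> {linear X0 -> X1}).
Context (i_cont : continuous i) (lin : linearisable i Lam).
Context (theta : R) (p : \bar R) (theta01 : 0 < theta < 1) (p1 : (1 <= p)%E).
Context (Z : set X1) (th : R) (Y : completeNormedModType (scalars R k)).
Context (Pi : {linear X1 -> Y}) (th01 : 0 < th < 1).
Context (order : interpolation_order i Lam Z th Pi).
Implicit Types (u : X0).

Local Notation a := (Kdyad i theta setT).

(** The contribution of one projection to [dyad m `^ (- theta)] times the K
    functional of the intersection. *)
Definition proj_dyad u m : R :=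
  dyad m `^ (th - theta) * rnorm (Pi (Lam (dyad m) u)).

Let a_ge0 u m : 0 <= a u m. Proof. exact: Kdyad_ge0. Qed.

Lemma proj_dyad_ge0 u m : 0 <= proj_dyad u m.
Proof. by rewrite mulr_ge0 ?powR_ge0 ?rnorm_ge0. Qed.

(** Written with [Kdyad], the sequence that decides membership in
    [X_0, X_1]_{theta,p}, the increment acquires the factor t^(theta - th), whose
    sign of exponent separates the three cases. *)
Lemma proj_diff : exists2 C, 0 <= C & forall m t u, dyad m.+1 <= t <= dyad m ->
  rnorm (Pi (Lam t u) - Pi (Lam (dyad m) u)) <=
    C * (dyad m `^ (theta - th) * a u m).
Proof.
have [C C0 PiC] := Pi_linearisation_diff lin th01 order.
exists C => // m t u tm; apply: (le_trans (PiC _ _ u tm)).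
by rewrite /Kdyad [_ * (_ * Kfun _ _ _ _)]mulrA -dyad_powRD addrAC subrr sub0r.
Qed.

Lemma proj_dist : exists2 C, 0 <= C & forall m t u, dyad m.+1 <= t <= dyad m ->
  `|rnorm (Pi (Lam t u)) - rnorm (Pi (Lam (dyad m) u))| <=
    C * (dyad m `^ (theta - th) * a u m).
Proof.
have [C C0 PiC] := proj_diff; exists C => // m t u tm.
apply: le_trans (PiC m t u tm); move: (Pi _) (Pi _) => x y.
have := ler_rnormD (x - y) y; have := ler_rnormD (y - x) x.
by rewrite !subrK (rnormB y) ler_norml => h1 h2; apply/andP; split; lra.
Qed.

Let dyad_powR_inv m : dyad m `^ (th - theta) * dyad m `^ (theta - th) = 1 :> R.
Proof. by rewrite -dyad_powRD addrA subrK subrr powRr0. Qed.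

Let dyadS_powR m x : dyad m.+1 `^ x = half_pow x * dyad m `^ x :> R.
Proof. by rewrite dyadS powRM ?invr_ge0 ?dyad_ge0. Qed.

(** For theta < th the weight [dyad m `^ (th - theta)] decreases with m, so the
    recursion contracts forwards. *)
Lemma proj_dyad_above u : theta < th -> ell p (a u) -> ell p (proj_dyad u).
Proof.
move=> thth; have [C C0 PiC] := proj_dist.
have /andP[q0 q1] := half_pow_lt1 (x := th - theta) (ltac:(lra)).
apply: (ell_forward (q := half_pow (th - theta)) (c := half_pow (th - theta) * C)) => //.
- by rewrite (ltW q0).
- by rewrite mulr_ge0 ?(ltW q0).
- exact: proj_dyad_ge0.
move=> m; rewrite /proj_dyad dyadS_powR -!mulrA -mulrDr ler_wpM2l ?(ltW q0)//.
have := PiC m (dyad m.+1) u; rewrite lexx dyad_le// => /(_ isT).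
rewrite ler_norml => /andP[_]; rewrite lerBlDl.
move=> /(ler_wpM2l (powR_ge0 (dyad m) (th - theta))).
rewrite mulrDr => /le_trans; apply; rewrite lerD2l mulrCA ler_wpM2l//.
by rewrite mulrA dyad_powR_inv mul1r.
Qed.

(** For th < theta the weight grows with m, so the recursion contracts backwards;
    the limit 0 is the boundary condition at infinity. *)
Lemma proj_dyad_below u : th < theta -> Pi (Lam t u) @[t --> 0^'+] --> (0 : Y) ->
  ell p (a u) -> ell p (proj_dyad u).
Proof.
move=> thth /cvg_at0_dyadic Pi0; have [C C0 PiC] := proj_dist.
have /andP[q0 q1] := half_pow_lt1 (x := theta - th) (ltac:(lra)).
have qV : half_pow (th - theta) * half_pow (theta - th) = 1.
  by rewrite /half_pow -powRD ?addrA ?subrK ?subrr ?powRr0// invr_eq0 pnatr_eq0 implybT.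
apply: (ell_backward (q := half_pow (theta - th)) (c := C)) => //.
- by rewrite q0.
- exact: proj_dyad_ge0.
- move=> m.
  have -> : half_pow (theta - th) * proj_dyad u m.+1 =
      dyad m `^ (th - theta) * rnorm (Pi (Lam (dyad m.+1) u)).
    rewrite /proj_dyad dyadS_powR !mulrA [half_pow _ * half_pow _]mulrC.
    by rewrite qV mul1r.
  rewrite /proj_dyad; have := PiC m (dyad m.+1) u; rewrite lexx dyad_le// => /(_ isT).
  rewrite ler_norml => /andP[+ _]; rewrite lerBrDr addrC lerBlDr.
  move=> /(ler_wpM2l (powR_ge0 (dyad m) (th - theta))).
  rewrite mulrDr => /le_trans; apply; rewrite lerD2l mulrCA ler_wpM2l//.
  by rewrite mulrA dyad_powR_inv mul1r.
- move=> e e0; have [N PiN] := Pi0 _ e0; exists N => m Nm.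
  rewrite /proj_dyad -dyad_powR mulrA [_ * dyad m `^ _]mulrC dyad_powR_inv mul1r.
  rewrite -rnormN -sub0r ltW// PiN// dyad_gt0 /=; exact: dyad_le.
Qed.

(** A bounded weighted sequence means ||Pi (Lam t u)|| = O(t^(theta - th)) along
    the dyadic points. *)
Lemma proj_dyad_below_limit0 u (y : Y) : th < theta ->
  Pi (Lam t u) @[t --> 0^'+] --> y -> ell p (proj_dyad u) -> y = 0.
Proof.
move=> thth /cvg_at0_dyadic Piy /(ell_bounded p1 (proj_dyad_ge0 u))[M M0 dM].
have /andP[q0 q1] := half_pow_lt1 (x := theta - th) (ltac:(lra)).
apply: rnorm_eq0; apply/eqP; rewrite eq_le rnorm_ge0 andbT.
apply/ler_addgt0Pr => e e0; rewrite add0r.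
have [N PiN] := Piy (e / 2) (ltac:(lra)).
have := @cvg_geometric _ M (half_pow (theta - th)).
rewrite gtr0_norm// => /(_ q1) /cvgrPdist_lt /(_ (e / 2) (ltac:(lra))).
move=> [m _ /(_ (m + N)%N)].
rewrite /= leq_addr sub0r normrN => /(_ isT) /(le_lt_trans (ler_norm _)) small.
have := PiN (dyad (m + N)%N); rewrite dyad_gt0 dyad_le ?leq_addl// => /(_ isT) yN.
have PiM : rnorm (Pi (Lam (dyad (m + N)%N) u)) <= M * half_pow (theta - th) ^+ (m + N).
  have := ler_wpM2l (powR_ge0 (dyad (m + N)) (theta - th)) (dM (m + N)%N).
  rewrite /proj_dyad mulrA [dyad _ `^ _ * _]mulrC dyad_powR_inv mul1r.
  by rewrite dyad_powR mulrC.
have := ler_rnormD (y - Pi (Lam (dyad (m + N)) u)) (Pi (Lam (dyad (m + N)) u)).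
rewrite subrK; lra.
Qed.

(** For th = theta the weight is 1 and t -> ||Pi (Lam t u)|| stays within an l^p
    error of its dyadic samples. *)
Lemma proj_dyad_critical u : th = theta -> ell p (a u) ->
  ell p (proj_dyad u) <->
  (Lp_dtt `]0%R, 1%R] p (fun t => rnorm (Pi (Lam t u))) < +oo)%E.
Proof.
move=> thth ea; have [C C0 PiC] := proj_dist.
have dE m : proj_dyad u m = rnorm (Pi (Lam (dyad m) u)).
  by rewrite /proj_dyad thth subrr powRr0 mul1r.
have aE m : dyad m `^ (theta - th) * a u m = a u m.
  by rewrite thth subrr powRr0 mul1r.
have unit_gt0 : (`]0, 1] : set R) `<=` [set t | 0 < t].
  by move=> t /=; rewrite in_itv/= => /andP[].
have Ca0 m : 0 <= C * a u m by rewrite mulr_ge0.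
have eCa : ell p (fun m => C * a u m) by exact: ell_scale.
have PiD m t : dyad m.+1 < t <= dyad m ->
    rnorm (Pi (Lam (dyad m) u)) - C * a u m <= rnorm (Pi (Lam t u)) <=
    rnorm (Pi (Lam (dyad m) u)) + C * a u m.
  move=> /andP[t1 t2]; have := PiC m t u; rewrite (ltW t1) t2 => /(_ isT).
  by rewrite aE ler_norml => /andP[h1 h2]; apply/andP; split; lra.
split=> [ed|Lf].
  apply: (@Lp_dtt_lty R p (fun m => proj_dyad u m + C * a u m) (fun=> 0)) => //.
  - by move=> m; rewrite addr_ge0 ?proj_dyad_ge0.
  - move=> m t _ /PiD /andP[_ h]; rewrite ger0_norm ?rnorm_ge0// (le_trans h)// dE.
    exact: lexx.
  - by move=> m t /=; rewrite in_itv/= => /andP[_ t1]; rewrite ltNge t1.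
  - by apply: ell_add => //; exact: proj_dyad_ge0.
  - exact: ell_zero.
(* truncated at 0, since the error may exceed the sample *)
pose b m := Num.max 0 (proj_dyad u m - C * a u m).
have b0 m : 0 <= b m by rewrite le_max lexx.
have bf m t : dyad m.+1 < t <= dyad m -> b m <= `|rnorm (Pi (Lam t u))|.
  by move=> /PiD /andP[h _]; rewrite ger0_norm ?rnorm_ge0// ge_max rnorm_ge0 dE.
have eb : ell p b.
  by apply: (ell_of_Lp_dtt p1 (measurable_itv _) (@subset_refl _ _) unit_gt0 b0 bf Lf).
apply: ell_le p1 _ (ell_add p1 b0 Ca0 eb eCa) => m.
by rewrite proj_dyad_ge0 -lerBlDr le_max lexx orbT.
Qed.

Lemma limit_of_proj_below u : th < theta -> interp_space i setT theta p u ->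
  cvg (Pi (Lam t u) @[t --> 0^'+]).
Proof.
move=> thth /(interp_spaceP i theta01 p1) => /(_ I) ea.
have [A A0 aA] := ell_bounded p1 (a_ge0 u) ea.
have [C C0 PiC] := proj_diff.
have q01 := half_pow_lt1 (x := theta - th) (ltac:(lra)).
apply: (dyadic_limit_cvg (B := C * A) _ q01); first by rewrite mulr_ge0.
move=> m t tm; apply: (le_trans (PiC m t u tm)).
by rewrite -mulrA ler_wpM2l// -dyad_powR mulrC ler_wpM2r ?powR_ge0.
Qed.

Lemma bound_of_proj_limit : th < theta -> exists C : R, forall u y,
  interp_space i setT theta p u -> Pi (Lam t u) @[t --> 0^'+] --> y ->
  ((rnorm y)%:E <= C%:E * interp_norm i setT theta p u)%E.
Proof.
move=> thth; have [C C0 PiC] := proj_diff.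
have [C1 C10 Pi1] := Pi_linearisation_one i_cont lin order.
have q01 := half_pow_lt1 (x := theta - th) (ltac:(lra)).
set q := half_pow _ in q01; have q1' : 0 < 1 - q by lra.
exists ((C1 + C / (1 - q)) * 4) => u y uE Piy.
have aN m := Kdyad_le_interp_norm i theta01 p1 u m (I : setT (0 : X1)).
move: uE aN; rewrite /interp_space/=; case: (interp_norm _ _ _ _ _) => [N| |] // _ aN.
  have aN' m : a u m <= 4 * N by rewrite -lee_fin; exact: aN.
  have N0 : 0 <= 4 * N := le_trans (a_ge0 u 0) (aN' 0%N).
  rewrite -EFinM lee_fin -mulrA mulrDl.
  have CN : 0 <= C * (4 * N) by rewrite mulr_ge0.
  apply: (le_trans (dyadic_limit_le CN q01 _ Piy)).
    move=> m t tm; apply: (le_trans (PiC m t u tm)).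
    by rewrite -mulrA ler_wpM2l// -dyad_powR mulrC ler_wpM2r ?powR_ge0.
  rewrite mulrAC lerD2r; apply: (le_trans (Pi1 u)); rewrite ler_wpM2l//.
  by have := aN' 0%N; rewrite /Kdyad [dyad 0]expr0 powR1 mul1r.
(* a norm equal to -oo contradicts the nonnegativity of the K functional *)
by have := aN 0%N; rewrite mulr_infty gtr0_sg// mul1e.
Qed.

End OneProjection.

(** * The intersection of independent subspaces *)

Section IndependentFamily.
Context {R : realType} {k : scalar_kind}.
Context {X0 X1 : completeNormedModType (scalars R k)}.
Context (i : {linear X1 -> X0}) (Lam : R -> {linear X0 -> X1}).
Context (lin : linearisable i Lam).
Context (n : nat) (Z : 'I_n -> set X1) (th : 'I_n -> R).
Context (Y : 'I_n -> completeNormedModType (scalars R k)).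
Context (Pi : forall j : 'I_n, {linear X1 -> Y j}).
Context (Z0 : forall j, Z j 0) (indep : independent_subspaces i Lam Z th Pi).
Context (theta : R) (p : \bar R) (theta01 : 0 < theta < 1) (p1 : (1 <= p)%E).
Implicit Types (u : X0).

Local Notation Zt := (\bigcap_(j in [set: 'I_n]) Z j).
Local Notation d u j := (proj_dyad Lam theta (th j) (Pi j) u).

Let Zt0 : Zt 0. Proof. by move=> j _; exact: Z0. Qed.

(** Independence, read at s = t and v = 0. *)
Lemma NJ_intersection : exists C1 C2, [/\ 0 <= C1, 0 <= C2 &
  forall t u, 0 < t <= 1 ->
    NJ i Zt t (Lam t u) <= C1 * \sum_(j < n) t `^ th j * rnorm (Pi j (Lam t u)) /\
    \sum_(j < n) t `^ th j * rnorm (Pi j (Lam t u)) <= C2 * NJ i Zt t (Lam t u)].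
Proof.
have [C1 [C2 [C10 C20 NP]]] := indep (lexx 1).
exists C1^-1, C2; split => [||t u t01]; first by rewrite invr_ge0 ltW.
  exact: ltW.
have := NP t t u 0 t01 t01; rewrite raddf0 addr0 invr1 mul1r lexx => /(_ isT).
by move=> /andP[h1 h2]; rewrite ler_pdivlMl.
Qed.

(** K for the intersection is equivalent to K(t,u) plus the sum of the
    t^(th_j) ||Pi_j (Lam t u)||, and a finite sum of nonnegative sequences is in
    l^p iff each of them is. *)
Lemma interp_intersectionP u : interp_space i Zt theta p u <->
  ell p (Kdyad i theta setT u) /\ forall j, ell p (d u j).
Proof.
have [C1 [C2 [C10 C20 NP]]] := NJ_intersection.
have [C3 C30 KN] := Kfun_intersection_le lin Zt0.
have [C4 C40 NK] := NJ_linearisation_le lin Zt0.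
have a0 m : 0 <= Kdyad i theta setT u m by exact: Kdyad_ge0.
have at0 m : 0 <= Kdyad i theta Zt u m by exact: Kdyad_ge0.
have d0 j m : 0 <= d u j m by exact: proj_dyad_ge0.
have dyad01 m : 0 < (dyad m : R) <= 1 by rewrite dyad_gt0 dyad_le1.
have sumE m : \sum_(j < n) d u j m = dyad m `^ (- theta) *
    \sum_(j < n) dyad m `^ th j * rnorm (Pi j (Lam (dyad m) u)).
  by rewrite mulr_sumr; apply: eq_bigr => j _; rewrite mulrA -dyad_powRD addrC.
rewrite (interp_spaceP i theta01 p1 u Zt0); split => [eZ|[ea ed]].
  split=> [|j].
    apply: ell_le p1 _ eZ => m; rewrite a0 ler_wpM2l ?powR_ge0//.
    exact: Kfun_subset (dyad_ge0 m).
  have C0 : 0 <= C2 * C4 by rewrite mulr_ge0.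
  apply: ell_le p1 _ (ell_scale p1 C0 at0 eZ) => m; rewrite d0/=.
  apply: (@le_trans _ _ (\sum_(j < n) d u j m)).
    by rewrite (bigD1 j)//= lerDl sumr_ge0.
  rewrite sumE mulrCA ler_wpM2l ?powR_ge0// -mulrA.
  have [_ /le_trans] := NP _ u (dyad01 m); apply.
  by rewrite ler_wpM2l// NK.
have s0 m : 0 <= \sum_(j < n) d u j m by rewrite sumr_ge0.
have es := ell_sum p1 d0 ed.
apply: ell_le p1 _ (ell_add p1 _ _ (ell_scale p1 C30 a0 ea) (ell_scale p1 C10 s0 es)).
- move=> m; rewrite at0/= sumE ![_ * (_ `^ _ * _)]mulrCA -mulrDr ler_wpM2l ?powR_ge0//.
  apply: (le_trans (KN _ u (dyad01 m))); rewrite lerD2l.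
  by have [] := NP _ u (dyad01 m).
- by move=> m; rewrite mulr_ge0.
- by move=> m; rewrite mulr_ge0.
Qed.

End IndependentFamily.

Lemma leq_last_below (R : realType) (n : nat) (th : 'I_n -> R) (theta : R) :
    (forall j l : 'I_n, (j < l)%N -> th j < th l) ->
  forall j : 'I_n, (j.+1 <= last_below th theta)%N = (th j < theta).
Proof.
move=> th_incr j; apply/idP/idP => [jk|thj]; last first.
  exact: (@leq_bigmax_cond _ (fun j => th j < theta) (fun j : 'I_n => j.+1)).
have : (0 < #|[pred l | (th l < theta)%R]|)%N.
  rewrite lt0n; apply: contraTneq jk => /card0_eq no_l.
  by rewrite /last_below big_pred0.
move=> /(eq_bigmax_cond (fun l : 'I_n => l.+1)) [l thl lE].
move: jk; rewrite /last_below lE ltnS; rewrite inE in thl.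
rewrite leq_eqVlt => /orP[/eqP/val_inj -> //|/th_incr jl].
exact: lt_trans jl thl.
Qed.

(** * The continuous extension of a projection *)

Section ContinuousExtension.
Context {R : realType} {k : scalar_kind}.
Context {X0 X1 : completeNormedModType (scalars R k)}.
Context (i : {linear X1 -> X0}) (Lam : R -> {linear X0 -> X1}).
Context (i_cont : continuous i) (lin : linearisable i Lam).
Context (theta : R) (p : \bar R) (theta01 : 0 < theta < 1) (p1 : (1 <= p)%E).
Context (Z : set X1) (th : R) (Y : completeNormedModType (scalars R k)).
Context (Pi : {linear X1 -> Y}) (th01 : 0 < th < 1).
Context (order : interpolation_order i Lam Z th Pi).

Definition proj_limit (u : X0) : Y := lim (Pi (Lam t u) @[t --> 0^'+]).

Lemma proj_limit_cvg u : th < theta -> interp_space i setT theta p u ->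
  Pi (Lam t u) @[t --> 0^'+] --> proj_limit u.
Proof. by move=> thth uE; exact: (limit_of_proj_below lin theta01 p1 th01 order). Qed.

Lemma proj_limit_extension : th < theta ->
  continuous_extension i Lam theta p Pi proj_limit.
Proof.
move=> thth; have cvgE := proj_limit_cvg thth.
split => [c u v uE vE||u|cvgPi w]; [| |exact: cvgE|].
- apply: cvg_lim => //.
  have -> : (fun t => Pi (Lam t (c *: u + v))) =
      (c \*: (fun t => Pi (Lam t u))) + (fun t => Pi (Lam t v)).
    by apply/funext => t; rewrite !linearP.
  by apply: cvgD; [apply: cvgZl_tmp; exact: cvgE|exact: cvgE].
- have [C PiC] := bound_of_proj_limit i_cont lin theta01 p1 th01 order thth.
  by exists C => u uE; apply: PiC => //; exact: cvgE.
- exact: cvg_lim (cvgPi w).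
Qed.

(** The kernel of the extension is described by the same l^p condition as the
    interpolation space of the intersection. *)
Lemma proj_limit_eq0P u : th < theta -> interp_space i setT theta p u ->
  proj_limit u = 0 <-> ell p (proj_dyad Lam theta th Pi u).
Proof.
move=> thth uE; have cvgu := proj_limit_cvg thth uE; split => [u0|].
  apply: (proj_dyad_below lin p1 th01 order thth); first by rewrite -u0.
  exact/(interp_spaceP i theta01 p1 u).
exact: (proj_dyad_below_limit0 p1 thth cvgu).
Qed.

End ContinuousExtension.

(** * Interpolation with the intersection *)

Theorem theorem5p2 (R : realType) (kind : scalar_kind)
    (X0 X1 : completeNormedModType (scalars R kind))
    (i : {linear X1 -> X0}) (Lam : R -> {linear X0 -> X1})
    (n : nat) (Z : 'I_n -> set X1) (th : 'I_n -> R)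
    (Y : 'I_n -> completeNormedModType (scalars R kind))
    (Pi : forall j : 'I_n, {linear X1 -> Y j})
    (theta : R) (p : \bar R)
    (i_inj : injective i) (i_cont : continuous i)
    (lin : linearisable i Lam)
    (Z_closed : forall j : 'I_n, closed_subspace (Z j))
    (th01 : forall j : 'I_n, 0 < th j < 1)
    (th_incr : forall j l : 'I_n, (j < l)%N -> th j < th l)
    (Z_order : forall j : 'I_n, interpolation_order i Lam (Z j) (th j) (Pi j))
    (Z_indep : independent_subspaces i Lam Z th Pi)
    (theta01 : 0 < theta < 1) (p1 : (1 <= p)%E) :
  let Ztilde := \bigcap_(j in [set: 'I_n]) Z j in
  ((forall j : 'I_n, theta != th j) ->
     let k := last_below th theta in
     exists Pe : forall j : 'I_n, X0 -> Y j,
       (forall j : 'I_n, (j.+1 <= k)%N ->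
          continuous_extension i Lam theta p (Pi j) (Pe j)) /\
       interp_space i Ztilde theta p =
         interp_space i setT theta p `&`
         \bigcap_(j in [set j : 'I_n | (j.+1 <= k)%N]) [set u | Pe j u = 0])
  /\
  (forall k : 'I_n, theta = th k ->
     exists Pe : forall j : 'I_n, X0 -> Y j,
       (forall j : 'I_n, (j < k)%N ->
          continuous_extension i Lam theta p (Pi j) (Pe j)) /\
       interp_space i Ztilde theta p =
         [set u | (interp_space i setT theta p `&`
                   \bigcap_(j in [set j : 'I_n | (j < k)%N])
                      [set u | Pe j u = 0]) u /\
                  (Lp_dtt `]0%R, 1%R] p (fun t => rnorm (Pi k (Lam t u))) < +oo)%E]).
Proof.
set Zt := \bigcap_(j in _) _.
have Z0 j : Z j 0 by case: (Z_closed j).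
pose Pe j := proj_limit Lam (Pi j).
have ext j : th j < theta -> continuous_extension i Lam theta p (Pi j) (Pe j).
  exact: (proj_limit_extension i_cont lin theta01 p1 (th01 j) (Z_order j)).
have spaceP u : interp_space i setT theta p u <-> ell p (Kdyad i theta setT u).
  exact: interp_spaceP.
have memP u := interp_intersectionP lin Z0 Z_indep theta01 p1 u.
have below u j : th j < theta -> interp_space i setT theta p u ->
    Pe j u = 0 <-> ell p (proj_dyad Lam theta (th j) (Pi j) u).
  exact: (proj_limit_eq0P lin theta01 p1 (th01 j) (Z_order j)).
have above u j : theta < th j -> interp_space i setT theta p u ->
    ell p (proj_dyad Lam theta (th j) (Pi j) u).
  by move=> thth /spaceP; exact: (proj_dyad_above lin p1 (th01 j) (Z_order j)).
split=> [th_neq kmax|k0 th_eq]; exists Pe.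
  have kmaxE (j : 'I_n) : (j.+1 <= kmax)%N = (th j < theta) by exact: leq_last_below.
  split=> [j|]; first by rewrite kmaxE; exact: ext.
  apply/seteqP; split => u /=.
    move=> /memP[/spaceP uE ud]; split => // j /=; rewrite kmaxE => thj.
    exact/below.
  move=> [uE u0]; apply/memP; split; first exact/spaceP.
  move=> j; have [thj|thj|thE] := ltgtP (th j) theta; last first.
  - by have := th_neq j; rewrite thE eqxx.
  - exact: above.
  - by apply/below => //; apply: u0; rewrite /= kmaxE.
have lt_k0 (j : 'I_n) : (j < k0)%N = (th j < theta).
  rewrite th_eq; case: ltngtP => [/th_incr ->//|/th_incr|/val_inj ->].
    by move=> /ltW; rewrite leNgt => /negbTE.
  by rewrite ltxx.
have critical u := proj_dyad_critical lin p1 (th01 k0) (Z_order k0) (u := u)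
  (esym th_eq).
split=> [j|]; first by rewrite lt_k0; exact: ext.
apply/seteqP; split => u /=.
  move=> /memP[ea ud]; have uE : interp_space i setT theta p u by exact/spaceP.
  split; last exact/critical.
  by split => // j /=; rewrite lt_k0 => thj; exact/below.
move=> [[uE u0] Lu]; have ea : ell p (Kdyad i theta setT u) by exact/spaceP.
apply/memP; split => // j; have [jk|kj|jk] := ltngtP j k0.
- by apply/below; rewrite -?lt_k0//; exact: u0.
- by apply: above => //; rewrite th_eq; exact: th_incr.
- by rewrite (val_inj jk); exact/critical.
Qed.
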